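(* Let $M$ and $N$ be finitely generated modules over a Dedekind domain $R$; let $X:=\operatorname{Ass}(N)-\{0\}$; and let $t$ be a positive integer. Then $\operatorname{sur}(M,N)\geqslant t$ if and only if $\operatorname{sur}(M_{\mathfrak m},N_{\mathfrak m})\geqslant t$ for every $\mathfrak m\in X$ and one of the following conditions holds: (1) $\operatorname{rank}(N)=0$. (2) $\operatorname{rank}(M)\geqslant 1+t\cdot\operatorname{rank}(N)$. (3) $\operatorname{rank}(M)=t\cdot\operatorname{rank}(N)\geqslant t$, and $[M]=[N]^t$. Moreover, if $\operatorname{sur}(M,N)\geqslant t$ and (3) holds, then $\operatorname{sur}(\operatorname{Tor}(M),\operatorname{Tor}(N))\geqslant t$ and $\operatorname{sur}(M,N)=t$.
   Context: A Dedekind domain is an integral domain in which every ideal is projective (so a field is a Dedekind domain). For a commutative ring $A$ and $A$-modules $P,Q$, $\operatorname{sur}_A(P,Q)$ is the supremum (possibly $\infty$) of the nonnegative integers $t$ such that there exists a surjective $A$-linear map $P\to Q^{\oplus t}$. Subscripts are omitted: $\operatorname{sur}(M,N)=\operatorname{sur}_R(M,N)$, $\operatorname{sur}(M_{\mathfrak m},N_{\mathfrak m})=\operatorname{sur}_{R_{\mathfrak m}}(M_{\mathfrak m},N_{\mathfrak m})$, $\operatorname{Ass}(N)=\operatorname{Ass}_R(N)$ (the set of associated primes of $N$; the zero ideal is removed from it to form $X$). $\operatorname{Tor}(M)$ denotes the torsion submodule of $M$, and $\operatorname{rank}(M)$ is the dimension of $M\otimes_R K$ over the fraction field $K$ of $R$.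 $\operatorname{Pic}(R)$ is the class group of $R$: nonzero fractional ideals modulo the relation $I\sim J$ iff $aI=bJ$ for some nonzero $a,b\in R$, with multiplication $[I][J]=[IJ]$ and identity $[R]$. If $M\neq\operatorname{Tor}(M)$ and $r=\operatorname{rank}(M)$, then $M/\operatorname{Tor}(M)\cong R^{\oplus(r-1)}\oplus I$ for a nonzero ideal $I$ of $R$, unique up to isomorphism; the class $[I]\in\operatorname{Pic}(R)$ is called the Steinitz class of $M$ and is denoted $[M]$. *)

(* Defs.v *)
From HB Require Import structures.
From mathcomp Require Import all_boot all_order all_algebra.
From mathcomp Require Import ring.
From mathcomp.multinomials Require Import freeg.
From mathcomp Require Import mathcomp_extra boolp classical_sets.
From mathcomp Require Import constructive_ereal.

Set Implicit Arguments.
Unset Strict Implicit.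
Unset Printing Implicit Defensive.

Import Order.TTheory GRing.Theory Num.Theory.

Local Open Scope ring_scope.
Local Open Scope classical_set_scope.
Local Open Scope quotient_scope.

(* Submodules are boolean predicates (`submodClosed V`); since the development
   is classical, this is no restriction. *)

Section Submodules.
Variables (R : nzRingType) (V : lmodType R).

Record submod (S : submodClosed V) :=
  Submod { submod_val : V; _ : submod_val \in S }.

HB.instance Definition _ S := [isSub for @submod_val S].
HB.instance Definition _ S := [Choice of submod S by <:].
HB.instance Definition _ S := [SubChoice_isSubLmodule of submod S by <:].

(* The submodule generated by A. *)
Definition gen_submod (A : set V) : {pred V} := fun v =>
  `[< forall S : {pred V}, submod_closed S -> A `<=` [set` S] -> v \in S >].

Lemma gen_submod_closed A : submod_closed (gen_submod A).
Proof.
split=> [|a u v /asboolP uA /asboolP vA].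
  by apply/asboolP => S [S0 _] _.
apply/asboolP => S Scl AS; have [_ Slin] := Scl.
by apply: Slin; [exact: uA|exact: vA].
Qed.

HB.instance Definition _ A :=
  GRing.isSubmodClosed.Build R V (gen_submod A) (gen_submod_closed A).

Lemma sub_gen_submod A : A `<=` [set` gen_submod A].
Proof. by move=> v Av; apply/asboolP => S _; apply. Qed.

Lemma gen_submod_min A (S : {pred V}) : submod_closed S -> A `<=` [set` S] ->
  {subset gen_submod A <= S}.
Proof. by move=> Scl AS v /asboolP; apply. Qed.

End Submodules.

Section QuotientModule.
Variables (R : nzRingType) (V : lmodType R) (S : submodClosed V).

(* `Quotient.quot` expects a `zmodClosed` predicate, which does not follow from
   `submodClosed` by inheritance. *)
Definition quot_pred : {pred V} := fun v => v \in S.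

Lemma quot_pred_closed : submod_closed quot_pred.
Proof. exact: GRing.submodClosedP. Qed.

HB.instance Definition _ :=
  GRing.isSubmodClosed.Build R V quot_pred quot_pred_closed.

Definition quotmod := Quotient.quot quot_pred.
HB.instance Definition _ :=
  ZmodQuotient.copy quotmod (Quotient.quot quot_pred).

Definition quotmod_scale (a : R) (x : quotmod) : quotmod :=
  \pi_quotmod (a *: repr x).

Lemma quotmod_scale_pi a v :
  quotmod_scale a (\pi_quotmod v) = \pi_quotmod (a *: v).
Proof.
apply/eqP; rewrite -Quotient.idealrBE -scalerBr; apply: rpredZ.
by rewrite Quotient.idealrBE reprK.
Qed.

Lemma quotmod_scaleA a b x :
  quotmod_scale a (quotmod_scale b x) = quotmod_scale (a * b) x.
Proof.
elim/quotW: x => v.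
by rewrite (quotmod_scale_pi b) !quotmod_scale_pi scalerA.
Qed.

Lemma quotmod_scale1 : left_id 1 quotmod_scale.
Proof. by elim/quotW => v; rewrite quotmod_scale_pi scale1r. Qed.

Lemma quotmod_scaleDr : right_distributive quotmod_scale +%R.
Proof.
move=> a; elim/quotW => u; elim/quotW => v.
by rewrite -pi_addr !quotmod_scale_pi scalerDr pi_addr.
Qed.

Lemma quotmod_scaleDl x : {morph quotmod_scale^~ x : a b / a + b}.
Proof.
by elim/quotW: x => v a b /=; rewrite !quotmod_scale_pi scalerDl pi_addr.
Qed.

HB.instance Definition _ := GRing.Zmodule_isLmodule.Build R quotmod
  quotmod_scaleA quotmod_scale1 quotmod_scaleDr quotmod_scaleDl.

End QuotientModule.

Definition fin_gen (R : nzRingType) (M : lmodType R) : Prop :=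
  exists n (g : 'I_n -> M), forall x, exists c : 'I_n -> R,
    x = \sum_(i < n) c i *: g i.

Definition projective (R : nzRingType) (P : lmodType R) : Prop :=
  forall (A B : lmodType R) (g : {linear A -> B}) (f : {linear P -> B}),
    (forall b, exists a, g a = b) ->
    exists h : {linear P -> A}, forall x, g (h x) = f x.

(* An ideal of R is an R-submodule of the regular module R^o; the library's
   `idealr` only covers proper ideals. *)
Definition dedekind (R : idomainType) : Prop :=
  forall I : submodClosed R^o, projective (submod I).

Definition iso_mod (R : nzRingType) (M N : lmodType R) : Prop :=
  exists f : {linear M -> N}, bijective f.

(* `{ffun 'I_t -> Q}` is the direct sum of t copies of Q.  The supremum is
   taken in \bar int so that it can be +oo; the set contains t = 0. *)
Definition sur (A : comNzRingType) (P Q : lmodType A) : \bar int :=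
  supremum 0%E [set t%:Z%:E | t in
    [set t : nat | exists f : {linear P -> {ffun 'I_t -> Q}},
                     forall y, exists x, f x = y]].

Definition Ass (R : comNzRingType) (N : lmodType R) (p : prime_idealr R) :
    Prop :=
  exists x : N, forall a, (a \in p) = (a *: x == 0).

Section Torsion.
Variables (R : idomainType) (M : lmodType R).

Definition Tor_pred : {pred M} :=
  fun x => `[< exists2 a, a != 0 & a *: x = 0 >].

Lemma Tor_closed : submod_closed Tor_pred.
Proof.
split=> [|c x y /asboolP[a a0 ax] /asboolP[b b0 by0]]; apply/asboolP.
  by exists 1; rewrite ?oner_neq0 // scaler0.
exists (a * b); first by rewrite mulf_neq0.
rewrite scalerDr -[(a * b) *: y]scalerA by0 scaler0 addr0 !scalerA.
have -> : a * b * c = b * c * a by ring.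
by rewrite -scalerA ax scaler0.
Qed.

HB.instance Definition _ := GRing.isSubmodClosed.Build R M Tor_pred Tor_closed.

Definition Tor := submod Tor_pred.
HB.instance Definition _ := GRing.Lmodule.copy Tor (submod Tor_pred).

Definition modTor := quotmod Tor_pred.
HB.instance Definition _ := GRing.Lmodule.copy modTor (quotmod Tor_pred).

End Torsion.

(* The fraction field K of R as an R-module. *)
Section FractionModule.
Variable R : idomainType.

Definition frac_scale (a : R) (x : {fraction R}) := tofrac a * x.

Lemma frac_scaleA a b x : frac_scale a (frac_scale b x) = frac_scale (a * b) x.
Proof. by rewrite /frac_scale rmorphM mulrA. Qed.
Lemma frac_scale1 : left_id 1 frac_scale.
Proof. by move=> x; rewrite /frac_scale rmorph1 mul1r. Qed.
Lemma frac_scaleDr : right_distributive frac_scale +%R.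
Proof. by move=> a x y; rewrite /frac_scale mulrDr. Qed.
Lemma frac_scaleDl x : {morph frac_scale^~ x : a b / a + b}.
Proof. by move=> a b; rewrite /frac_scale rmorphD mulrDl. Qed.

HB.instance Definition _ := GRing.Zmodule_isLmodule.Build R {fraction R}
  frac_scaleA frac_scale1 frac_scaleDr frac_scaleDl.

Lemma frac_scaleE (a : R) (x : {fraction R}) : a *: x = tofrac a * x.
Proof. by []. Qed.

End FractionModule.

Section ExtensionOfScalars.
Variables (R : comNzRingType) (A : comNzRingType) (phi : {rmorphism R -> A}).
Variable M : lmodType R.

(* M (x)_R A as an A-module: the free A-module on the symbols <<m>> = m (x) 1,
   modulo additivity and R-linearity in m; thus m (x) a is the class of
   <<a *g m>>. *)
Inductive tensor_rel : {freeg M / A} -> Prop :=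
| tensor_relD m m' : tensor_rel (<< m + m' >> - << m >> - << m' >>)
| tensor_relZ a m : tensor_rel (<< a *: m >> - << phi a *g m >>).

Definition extscal := quotmod (gen_submod tensor_rel).
HB.instance Definition _ :=
  GRing.Lmodule.copy extscal (quotmod (gen_submod tensor_rel)).

End ExtensionOfScalars.

(* The dimension of V when V has a finite basis, and 0 otherwise. *)
Definition dimension (K : fieldType) (V : lmodType K) : nat :=
  xget 0%N [set n | exists b : 'I_n -> V,
    bijective (fun c : 'rV[K]_n => \sum_(i < n) c 0 i *: b i)].

Definition rank (R : idomainType) (M : lmodType R) : nat :=
  dimension (extscal (@tofrac R) M).

Section Localization.
Variables (R : idomainType) (p : prime_idealr R).

(* R_p as the subring of the a/s in the fraction field with s outside p. *)
Definition local_pred : {pred {fraction R}} := fun x =>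
  `[< exists a s : R, s \notin p /\ x = tofrac a / tofrac s >].

Lemma notin_prime1 : 1 \notin p.
Proof. by rewrite idealr1. Qed.

Lemma notin_primeM s t : s \notin p -> t \notin p -> s * t \notin p.
Proof. by move=> sp tp; rewrite prime_idealrM negb_or sp. Qed.

Lemma tofrac_notin s : s \notin p -> tofrac s != 0.
Proof. by rewrite tofrac_eq0; apply: contraNneq => ->; apply: idealr0. Qed.

Lemma local_closed : subring_closed local_pred.
Proof.
split=> [|x y|x y].
- apply/asboolP; exists 1, 1; split; first exact: notin_prime1.
  by rewrite rmorph1 divr1.
- move=> /asboolP[a [s [sp ->]]] /asboolP[b [t [tp ->]]]; apply/asboolP.
  exists (a * t - b * s), (s * t); split; first exact: notin_primeM.
  by rewrite -mulNr addf_div ?tofrac_notin // mulNr rmorphB !rmorphM.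
- move=> /asboolP[a [s [sp ->]]] /asboolP[b [t [tp ->]]]; apply/asboolP.
  exists (a * b), (s * t); split; first exact: notin_primeM.
  by rewrite mulf_div !rmorphM.
Qed.

HB.instance Definition _ :=
  GRing.isSubringClosed.Build {fraction R} local_pred local_closed.

Record local_ring :=
  LocalRing { local_val : {fraction R}; _ : local_val \in local_pred }.

HB.instance Definition _ := [isSub for local_val].
HB.instance Definition _ := [Choice of local_ring by <:].
HB.instance Definition _ := [SubChoice_isSubComNzRing of local_ring by <:].

Lemma local_fracP (r : local_ring) : exists as_ : R * R,
  as_.2 \notin p /\ val r = tofrac as_.1 / tofrac as_.2.
Proof. by have /asboolP[a [s H]] := valP r; exists (a, s). Qed.

Definition local_frac r := sval (cid (local_fracP r)).
Definition local_num r := (local_frac r).1.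
Definition local_den r := (local_frac r).2.

Lemma local_denP r : local_den r \notin p.
Proof. by have [] := svalP (cid (local_fracP r)). Qed.

Lemma local_valE r : val r = tofrac (local_num r) / tofrac (local_den r).
Proof. by have [] := svalP (cid (local_fracP r)). Qed.

Section Module.
Variable M : lmodType R.

(* M_p is the set of fractions m/s with s outside p, where m/s = n/t iff
   u (t m - s n) = 0 for some u outside p. *)
Record prefrac :=
  Prefrac { frac_pair : M * R; frac_denP : frac_pair.2 \notin p }.

HB.instance Definition _ := [isSub for frac_pair].
HB.instance Definition _ := [Choice of prefrac by <:].

Definition pnum x := (frac_pair x).1.
Definition pden x := (frac_pair x).2.

Definition mkfrac (x : M) (s : R) (sp : s \notin p) : prefrac :=
  @Prefrac (x, s) sp.

Definition frac_equiv (x y : prefrac) : bool :=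
  `[< exists2 u, u \notin p &
        u *: (pden y *: pnum x) = u *: (pden x *: pnum y) >].

Lemma frac_equivP x y :
  reflect (exists2 u, u \notin p &
             (u * pden y) *: pnum x = (u * pden x) *: pnum y)
          (frac_equiv x y).
Proof.
by apply: (iffP (asboolP _)) => -[u up H]; exists u => //; move: H;
  rewrite !scalerA.
Qed.

Lemma frac_equiv_is_equiv : equiv_class_of frac_equiv.
Proof.
split=> [x|x y|y x z].
- by apply/frac_equivP; exists 1 => //; exact: notin_prime1.
- by apply/frac_equivP/frac_equivP => -[u up H]; exists u.
move=> /frac_equivP[u up E] /frac_equivP[w wp F].
apply/frac_equivP; exists (u * w * pden y).
  by apply: notin_primeM; [exact: notin_primeM|exact: frac_denP].
have -> : u * w * pden y * pden z = w * pden z * (u * pden y) by ring.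
rewrite -scalerA E scalerA.
have -> : w * pden z * (u * pden x) = u * pden x * (w * pden z) by ring.
by rewrite -scalerA F scalerA; congr (_ *: _); ring.
Qed.

Canonical frac_equiv_equiv := EquivRelPack frac_equiv_is_equiv.

Definition localization := {eq_quot frac_equiv}.
HB.instance Definition _ := Choice.on localization.
HB.instance Definition _ : EqQuotient prefrac frac_equiv localization :=
  EqQuotient.on localization.

(* The fraction m/s. *)
Definition lfrac m s (sp : s \notin p) : localization :=
  \pi_localization (mkfrac m sp).

Lemma lfracP m s sp n t tp :
  (exists2 u, u \notin p & (u * t) *: m = (u * s) *: n) <->
  @lfrac m s sp = @lfrac n t tp.
Proof.
split=> [H|/eqquotP/frac_equivP //].
by apply/eqquotP/frac_equivP.
Qed.

Lemma lfracW (P : localization -> Prop) :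
  (forall m s sp, P (@lfrac m s sp)) -> forall x, P x.
Proof. by move=> H; elim/quotW => -[[m s] sp]; apply: H. Qed.

Definition local_zero : localization := lfrac 0 notin_prime1.

Definition local_opp (x : localization) : localization :=
  lfrac (- pnum (repr x)) (frac_denP (repr x)).

Definition local_add (x y : localization) : localization :=
  lfrac (pden (repr y) *: pnum (repr x) +
         pden (repr x) *: pnum (repr y))
        (notin_primeM (frac_denP (repr x)) (frac_denP (repr y))).

Definition local_scale (r : local_ring) (x : localization) : localization :=
  lfrac (local_num r *: pnum (repr x))
        (notin_primeM (local_denP r) (frac_denP (repr x))).

Lemma repr_lfrac m s (sp : s \notin p) : exists2 u, u \notin p &
  (u * s) *: pnum (repr (lfrac m sp)) =
  (u * pden (repr (lfrac m sp))) *: m.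
Proof.
have : lfrac (pnum (repr (lfrac m sp))) (frac_denP (repr (lfrac m sp)))
       = lfrac m sp.
  rewrite -[RHS]reprK; congr (\pi_localization _).
  by apply: val_inj => /=; rewrite -surjective_pairing.
by move/lfracP.
Qed.

Lemma local_oppE m s sp : local_opp (@lfrac m s sp) = lfrac (- m) sp.
Proof.
apply/lfracP; have [u up E] := repr_lfrac m sp.
by exists u => //; rewrite !scalerN E.
Qed.

Lemma local_addE m s sp n t tp :
  local_add (@lfrac m s sp) (@lfrac n t tp) =
  lfrac (t *: m + s *: n) (notin_primeM sp tp).
Proof.
apply/lfracP; have [u up] := repr_lfrac m sp; have [v vp] := repr_lfrac n tp.
move: (repr (lfrac m sp)) (repr (lfrac n tp)) => -[[m' s'] sp'] [[n' t'] tp'].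
rewrite /pnum /pden /= => F E.
exists (u * v); first exact: notin_primeM.
rewrite !scalerDr !scalerA; congr (_ + _).
  have -> : u * v * (s * t) * t' = v * t * t' * (u * s) by ring.
  by rewrite -scalerA E scalerA; congr (_ *: _); ring.
have -> : u * v * (s * t) * s' = u * s * s' * (v * t) by ring.
by rewrite -scalerA F scalerA; congr (_ *: _); ring.
Qed.

Lemma local_scaleE r a b (bp : b \notin p) m s sp :
  val r = tofrac a / tofrac b ->
  local_scale r (@lfrac m s sp) = lfrac (a *: m) (notin_primeM bp sp).
Proof.
rewrite local_valE /local_scale.
move: (local_num r) (local_den r) (local_denP r) => c d dp /eqP.
rewrite eqr_div ?tofrac_notin // -!rmorphM tofrac_eq => /eqP E.
apply/lfracP; have [u up F] := repr_lfrac m sp; exists u => //.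
move: F; move: (repr (lfrac m sp)) => -[[m' s'] sp'].
rewrite /pnum /pden /= => F.
rewrite !scalerA.
have -> : u * (b * s) * c = c * b * (u * s) by ring.
by rewrite E -[LHS]scalerA F scalerA; congr (_ *: _); ring.
Qed.

Lemma local_addA : associative local_add.
Proof.
elim/lfracW => m s sp; elim/lfracW => n t tp; elim/lfracW => q v vp.
rewrite (local_addE n tp) (local_addE m sp) !local_addE; apply/lfracP.
exists 1; first exact: notin_prime1.
by rewrite !scalerDr !scalerA addrA; do ![congr (_ + _)]; congr (_ *: _); ring.
Qed.

Lemma local_addC : commutative local_add.
Proof.
elim/lfracW => m s sp; elim/lfracW => n t tp; rewrite !local_addE.
apply/lfracP; exists 1; first exact: notin_prime1.
by rewrite addrC [s * t]mulrC.
Qed.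

Lemma local_add0 : left_id local_zero local_add.
Proof.
elim/lfracW => m s sp; rewrite local_addE; apply/lfracP.
exists 1; first exact: notin_prime1.
by rewrite scaler0 add0r scale1r !mul1r.
Qed.

Lemma local_addN : left_inverse local_zero local_opp local_add.
Proof.
elim/lfracW => m s sp; rewrite local_oppE local_addE; apply/lfracP.
exists 1; first exact: notin_prime1.
by rewrite scalerN addNr !scaler0.
Qed.

HB.instance Definition _ := GRing.isZmodule.Build localization
  local_addA local_addC local_add0 local_addN.

Lemma local_scaleA a b x :
  local_scale a (local_scale b x) = local_scale (a * b) x.
Proof.
elim/lfracW: x => m s sp.
have ap := local_denP a; have bp := local_denP b.
rewrite (local_scaleE bp _ _ (local_valE b)).
rewrite (local_scaleE ap _ _ (local_valE a)).
have E : val (a * b) = tofrac (local_num a * local_num b) /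
                       tofrac (local_den a * local_den b).
  by rewrite rmorphM /= !local_valE mulf_div !rmorphM.
rewrite (local_scaleE (notin_primeM ap bp) _ _ E); apply/lfracP.
exists 1; first exact: notin_prime1.
by rewrite !scalerA; congr (_ *: _); ring.
Qed.

Lemma local_scale1 : left_id 1 local_scale.
Proof.
elim/lfracW => m s sp.
have E : val (1 : local_ring) = tofrac 1 / tofrac 1 by rewrite rmorph1 divr1.
rewrite (local_scaleE notin_prime1 _ _ E); apply/lfracP.
by exists 1; [exact: notin_prime1|rewrite !scale1r !mul1r].
Qed.

Lemma local_scaleDr : right_distributive local_scale +%R.
Proof.
move=> a; elim/lfracW => m s sp; elim/lfracW => n t tp.
have ap := local_denP a; have E := local_valE a.
rewrite [_ + _]local_addE !(local_scaleE ap _ _ E) [RHS]local_addE.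
apply/lfracP.
exists 1; first exact: notin_prime1.
by rewrite !scalerDr !scalerA; congr (_ *: _ + _ *: _); ring.
Qed.

Lemma local_scaleDl x : {morph local_scale^~ x : a b / a + b}.
Proof.
elim/lfracW: x => m s sp a b.
have ap := local_denP a; have bp := local_denP b.
have E : val (a + b) = tofrac (local_num a * local_den b +
    local_num b * local_den a) / tofrac (local_den a * local_den b).
  by rewrite rmorphD /= !local_valE addf_div ?tofrac_notin // rmorphD !rmorphM.
rewrite (local_scaleE (notin_primeM ap bp) _ _ E).
rewrite (local_scaleE ap _ _ (local_valE a)).
rewrite (local_scaleE bp _ _ (local_valE b)).
rewrite [RHS]local_addE; apply/lfracP.
exists 1; first exact: notin_prime1.
by rewrite !scalerDr !scalerA -scalerDl; congr (_ *: _); ring.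
Qed.

HB.instance Definition _ := GRing.Zmodule_isLmodule.Build
  local_ring localization local_scaleA local_scale1 local_scaleDr local_scaleDl.

End Module.
End Localization.

Section ClassGroup.
Variable R : idomainType.
Local Notation K := {fraction R}.

(* Nonzero fractional ideals: nonzero R-submodules I of K with d I contained in
   R for some nonzero d in R. *)
Record fracIdeal := FracIdeal {
  fi_fun : K -> bool;
  fi_closed : submod_closed fi_fun;
  fi_neq0 : exists2 x, x \in fi_fun & x != 0;
  fi_denom : exists2 d : R, d != 0 &
    forall x, x \in fi_fun -> exists a : R, d *: x = tofrac a }.

Coercion fi_pred (I : fracIdeal) : {pred K} := fi_fun I.

HB.instance Definition _ := gen_eqMixin fracIdeal.
HB.instance Definition _ := gen_choiceMixin fracIdeal.

Lemma fracIdealP (I J : fracIdeal) : I =i J -> I = J.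
Proof.
case: I J => [I Ic I0 Id] [J Jc J0 Jd] /= IJ.
have E : I = J by apply/funext => x; exact: IJ.
by subst J; congr FracIdeal; exact: Prop_irrelevance.
Qed.

Definition fi_dvd (a b : R) (I J : fracIdeal) : Prop :=
  forall x, x \in I -> exists2 y, y \in J & a *: x = b *: y.

Definition fi_equiv (I J : fracIdeal) : bool :=
  `[< exists a b : R, [/\ a != 0, b != 0 &
        [set a *: x | x in [set` I]] = [set b *: y | y in [set` J]]] >].

Lemma fi_equivP (I J : fracIdeal) : reflect
  (exists a b : R, [/\ a != 0, b != 0, fi_dvd a b I J & fi_dvd b a J I])
  (fi_equiv I J).
Proof.
apply: (iffP (asboolP _)) => -[a [b [a0 b0]]].
  move=> E; exists a, b; split=> // [x xI|y yJ].
    have : [set a *: x | x in [set` I]] (a *: x) by exists x.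
    by rewrite E => -[y yJ <-]; exists y.
  have : [set b *: y | y in [set` J]] (b *: y) by exists y.
  by rewrite -E => -[x xI <-]; exists x.
move=> IJ JI; exists a, b; split=> //; apply/seteqP.
split=> _ [x /= xI <-]; first by have [y yJ ->] := IJ x xI; exists y.
by have [y yJ ->] := JI x xI; exists y.
Qed.

Lemma fi_dvd_trans a b c d I J L :
  fi_dvd a b I J -> fi_dvd c d J L -> fi_dvd (c * a) (b * d) I L.
Proof.
move=> IJ JL x /IJ[y /JL[z zL E] F]; exists z => //.
by rewrite -[LHS]scalerA F scalerA [c * b]mulrC -[LHS]scalerA E scalerA.
Qed.

Lemma fi_equiv_is_equiv : equiv_class_of fi_equiv.
Proof.
split=> [I|I J|J I L].
- apply/fi_equivP; exists 1, 1; split; rewrite ?oner_neq0 // => x xI;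
  by exists x.
- by apply/fi_equivP/fi_equivP => -[a [b [a0 b0 H1 H2]]]; exists b, a.
move=> /fi_equivP[a [b [a0 b0 IJ JI]]] /fi_equivP[c [d [c0 d0 JL LJ]]].
apply/fi_equivP; exists (c * a), (b * d); rewrite !mulf_neq0 //; split=> //.
  exact: fi_dvd_trans IJ JL.
exact: fi_dvd_trans LJ JI.
Qed.

Canonical fi_equiv_equiv := EquivRelPack fi_equiv_is_equiv.
Canonical fi_equiv_encModRel := defaultEncModRel fi_equiv.

Definition Pic := {eq_quot fi_equiv}.
HB.instance Definition _ := Choice.on Pic.
HB.instance Definition _ : EqQuotient fracIdeal fi_equiv Pic :=
  EqQuotient.on Pic.

Definition Pic_class (I : fracIdeal) : Pic := \pi_Pic I.

Lemma Pic_classP I J : Pic_class I = Pic_class J <-> fi_equiv I J.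
Proof. by split=> [/eqquotP //|H]; apply/eqquotP. Qed.

Section Product.
Variables I J : fracIdeal.

Definition fi_mul_pred : {pred K} :=
  gen_submod (fun z : K => exists x y, [/\ x \in I, y \in J & z = x * y]).

Lemma mem_fi_mul x y : x \in I -> y \in J -> x * y \in fi_mul_pred.
Proof. by move=> xI yJ; apply: sub_gen_submod; exists x, y. Qed.

Lemma fi_mul_min (S : {pred K}) : submod_closed S ->
  (forall x y, x \in I -> y \in J -> x * y \in S) -> {subset fi_mul_pred <= S}.
Proof.
by move=> Sc H; apply: gen_submod_min => // _ [x [y [xI yJ ->]]]; apply: H.
Qed.

Lemma fi_mul_neq0 : exists2 x, x \in fi_mul_pred & x != 0.
Proof.
have [x xI x0] := fi_neq0 I; have [y yJ y0] := fi_neq0 J.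
by exists (x * y); [exact: mem_fi_mul|rewrite mulf_neq0].
Qed.

Lemma fi_mul_denom : exists2 d : R, d != 0 &
  forall x, x \in fi_mul_pred -> exists a : R, d *: x = tofrac a.
Proof.
have [d d0 dI] := fi_denom I; have [e e0 eJ] := fi_denom J.
exists (d * e); first by rewrite mulf_neq0.
suff H : {subset fi_mul_pred <= fun x : K =>
    `[< exists a : R, (d * e) *: x = tofrac a >]}.
  by move=> x /H/asboolP.
apply: fi_mul_min => [|x y /dI[a xa] /eJ[b yb]].
  split=> [|c x y /asboolP[a xa] /asboolP[b yb]]; apply/asboolP.
    by exists 0; rewrite scaler0 rmorph0.
  exists (c * a + b); rewrite scalerDr yb scalerA mulrC -scalerA xa.
  by rewrite frac_scaleE rmorphD rmorphM.
apply/asboolP; exists (a * b).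
rewrite rmorphM /= -xa -yb !frac_scaleE rmorphM /=.
by rewrite mulrACA.
Qed.

Definition fi_mul := FracIdeal (gen_submod_closed _) fi_mul_neq0 fi_mul_denom.

End Product.

Definition fi_one_pred : {pred K} := fun x => `[< exists a : R, x = tofrac a >].

Lemma fi_one_closed : submod_closed fi_one_pred.
Proof.
split=> [|c x y /asboolP[a ->] /asboolP[b ->]]; apply/asboolP.
  by exists 0; rewrite rmorph0.
by exists (c * a + b); rewrite frac_scaleE rmorphD rmorphM.
Qed.

Lemma fi_one_neq0 : exists2 x, x \in fi_one_pred & x != 0.
Proof.
by exists 1; [apply/asboolP; exists 1; rewrite rmorph1|exact: oner_neq0].
Qed.

Lemma fi_one_denom : exists2 d : R, d != 0 &
  forall x, x \in fi_one_pred -> exists a : R, d *: x = tofrac a.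
Proof.
exists 1; first exact: oner_neq0.
by move=> x /asboolP[a ->]; exists a; rewrite scale1r.
Qed.

Definition fi_one := FracIdeal fi_one_closed fi_one_neq0 fi_one_denom.

(* A nonzero ideal of R, seen as a fractional ideal. *)
Section IdealToFractional.
Variables (I : submodClosed R^o) (I0 : exists2 a : R, a \in I & a != 0).

Definition fi_ideal_pred : {pred K} :=
  fun x => `[< exists2 a : R, a \in I & x = tofrac a >].

Lemma fi_ideal_closed : submod_closed fi_ideal_pred.
Proof.
split=> [|c x y /asboolP[a aI ->] /asboolP[b bI ->]]; apply/asboolP.
  by exists 0; [exact: rpred0|rewrite rmorph0].
exists (c * a + b); last by rewrite frac_scaleE rmorphD rmorphM.
by have [_ Il] := GRing.submodClosedP I; exact: Il.
Qed.

Lemma fi_ideal_neq0 : exists2 x, x \in fi_ideal_pred & x != 0.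
Proof.
have [a aI a0] := I0; exists (tofrac a); last by rewrite tofrac_eq0.
by apply/asboolP; exists a.
Qed.

Lemma fi_ideal_denom : exists2 d : R, d != 0 &
  forall x, x \in fi_ideal_pred -> exists a : R, d *: x = tofrac a.
Proof.
exists 1; first exact: oner_neq0.
by move=> x /asboolP[a _ ->]; exists a; rewrite scale1r.
Qed.

Definition fi_ideal := FracIdeal fi_ideal_closed fi_ideal_neq0 fi_ideal_denom.

End IdealToFractional.

Lemma fi_dvd_mul a b c d I I' J J' : fi_dvd a b I I' -> fi_dvd c d J J' ->
  fi_dvd (a * c) (b * d) (fi_mul I J) (fi_mul I' J').
Proof.
move=> II JJ.
suff H : {subset fi_mul I J <= fun x : K =>
    `[< exists2 y, y \in fi_mul I' J' & (a * c) *: x = (b * d) *: y >]}.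
  by move=> x /H/asboolP.
have [M0 Ml] := fi_closed (fi_mul I' J').
apply: fi_mul_min => [|x y /II[x' x'I xx] /JJ[y' y'J yy]].
  split=> [|r x y /asboolP[u uM xu] /asboolP[v vM yv]]; apply/asboolP.
    by exists 0; rewrite ?scaler0.
  exists (r *: u + v); first exact: Ml.
  have sC k (w : K) : k *: (r *: w) = r *: (k *: w) by rewrite !scalerA mulrC.
  by rewrite !scalerDr !sC xu yv.
apply/asboolP; exists (x' * y'); first exact: mem_fi_mul.
move: xx yy; rewrite !frac_scaleE !rmorphM /= => xx yy.
by rewrite mulrACA xx yy mulrACA.
Qed.

Definition Pic_mul (x y : Pic) : Pic := Pic_class (fi_mul (repr x) (repr y)).

Lemma Pic_mulE I J :
  Pic_mul (Pic_class I) (Pic_class J) = Pic_class (fi_mul I J).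
Proof.
have reprP (L : fracIdeal) : fi_equiv (repr (Pic_class L)) L.
  by apply/Pic_classP; exact: reprK.
have /fi_equivP[a [b [a0 b0 H1 H2]]] := reprP I.
have /fi_equivP[c [d [c0 d0 H3 H4]]] := reprP J.
apply/Pic_classP/fi_equivP; exists (a * c), (b * d).
by rewrite !mulf_neq0 //; split=> //; apply: fi_dvd_mul.
Qed.

Lemma fi_mulC I J : fi_mul I J = fi_mul J I.
Proof.
apply: fracIdealP => x; apply/idP/idP; apply: fi_mul_min x;
  [exact: fi_closed| |exact: fi_closed|] => x y xI yJ;
  by rewrite mulrC; exact: mem_fi_mul.
Qed.

Lemma fi_mulA_sub I J L :
  {subset fi_mul I (fi_mul J L) <= fi_mul (fi_mul I J) L}.
Proof.
have [M0 Ml] := fi_closed (fi_mul (fi_mul I J) L).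
apply: fi_mul_min => [//|x w xI wJL]; move: w wJL.
suff H : {subset fi_mul J L <= fun w : K => x * w \in fi_mul (fi_mul I J) L}.
  by move=> w /H.
apply: fi_mul_min => [|y z yJ zL].
  split=> [|r u v uM vM]; rewrite unfold_in /= ?mulr0 //.
  rewrite mulrDr frac_scaleE mulrCA -frac_scaleE; exact: Ml.
by rewrite unfold_in mulrA; do 2?[apply: mem_fi_mul].
Qed.

Lemma fi_mulA I J L : fi_mul I (fi_mul J L) = fi_mul (fi_mul I J) L.
Proof.
apply: fracIdealP => x; apply/idP/idP; first exact: fi_mulA_sub.
rewrite fi_mulC [fi_mul I J]fi_mulC => /fi_mulA_sub.
by rewrite fi_mulC [fi_mul L J]fi_mulC.
Qed.

Lemma fi_mul1 I : fi_mul fi_one I = I.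
Proof.
apply: fracIdealP => x; apply/idP/idP => [|xI].
  have [I0 Il] := fi_closed I.
  apply: fi_mul_min x => [//|_ y /asboolP[a ->] yI].
  by rewrite -frac_scaleE -[_ *: _]addr0; apply: Il.
rewrite -[x]mul1r; apply: mem_fi_mul => //.
by apply/asboolP; exists 1; rewrite rmorph1.
Qed.

Lemma PicW (P : Pic -> Prop) : (forall I, P (Pic_class I)) -> forall x, P x.
Proof. by move=> H; elim/quotW => I; exact: H. Qed.

Definition Pic_one : Pic := Pic_class fi_one.

Lemma Pic_mulA : associative Pic_mul.
Proof.
elim/PicW => I; elim/PicW => J; elim/PicW => L.
by rewrite (Pic_mulE J L) (Pic_mulE I J) !Pic_mulE fi_mulA.
Qed.

Lemma Pic_mul1 : left_id Pic_one Pic_mul.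
Proof. by elim/PicW => I; rewrite Pic_mulE fi_mul1. Qed.

Lemma Pic_mulr1 : right_id Pic_one Pic_mul.
Proof. by elim/PicW => I; rewrite Pic_mulE fi_mulC fi_mul1. Qed.

(* Over an arbitrary domain this is only a monoid; inverses, which are not used
   here, exist when R is Dedekind. *)
HB.instance Definition _ := isMonoid.Build Pic Pic_mulA Pic_mul1 Pic_mulr1.

End ClassGroup.

(* The class of a nonzero ideal I with M/Tor(M) ~ R^(r-1) (+) I, where
   r = rank M; meaningful when M <> Tor(M) and R is Dedekind. *)
Definition steinitz (R : idomainType) (M : lmodType R) : Pic R :=
  xget (1%g : Pic R) [set c | exists I : submodClosed R^o,
    exists I0 : exists2 a : R, a \in I & a != 0,
      c = Pic_class (fi_ideal I0) /\
      iso_mod (modTor M) ({ffun 'I_(rank M).-1 -> R^o} * submod I)%type].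

(* Main.v *)
From HB Require Import structures.
From mathcomp.multinomials Require Import freeg.
Require Import Defs.
From mathcomp Require Import all_boot all_order all_algebra.
From mathcomp Require Import ring zify.
From mathcomp Require Import boolp classical_sets constructive_ereal.

(* Write T for torsion submodules, F = (N/T(N))^t, s = rank N and r = rank M.

   A surjection M -> N^t induces a surjection g : M -> F, so r >= ts, and if
   r = ts the kernel of g has rank 0, so is T(M).  Then M/T(M) is isomorphic to
   F, which compares Steinitz classes, and T(M) maps onto T(N)^t.

   Conversely, the condition on ranks and classes yields a surjection
   g : M -> F: modules R^a + I are compared through I + J = R + IJ.  As F is
   projective, M = L + F with L = ker g, and it remains to map L onto T(N)^t.
   This can be done one prime m in Ass(N) at a time, since T(N) is killed by a
   nonzero ideal J and R/J is a product of local rings.  At m, the surjection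
   M_m -> N_m^t restricts to a surjection onto T(N)_m^t of the kernel M' of
   M_m -> F_m.  Both L_m and M' are the sum of T(M)_m and a free module of rank
   r - ts, so they are isomorphic. *)

Set Implicit Arguments.
Unset Strict Implicit.
Unset Printing Implicit Defensive.

Import Order.TTheory GRing.Theory Num.Theory.

Local Open Scope ring_scope.
Local Open Scope quotient_scope.

(** * Linear maps and quotients *)

(** The only input about R is that ideals are projective; everything is drawn from its dual-basis
    form I * ((y) : I) = (y), including finite generation and both chain conditions used below. The
    obstacle is that a local surjection and the global map g onto F need not have the same kernel;
    only the ranks of the two kernels agree. So g is chosen first, from ranks and classes alone, and
    local surjections are used only for their effect on torsion, after transport to ker g. The
    transport exists because a torsion-free module is determined locally by its rank. Classes matter
    only when r = ts: for r > ts a spare ideal summand absorbs the difference. Maps over the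
    localization are avoided by clearing denominators: a map is locally onto at p when every z has a
    multiple u z in the image, with u outside p. Likewise the product decomposition of R/J becomes
    an induction on elements e of R: a property is proved when R/(J : e) is local, and glued along b
    + c = 1 when e b c lies in J. *)

Lemma mk_linear (R : nzRingType) (U V : lmodType R) (f : U -> V) :
  (forall a x y, f (a *: x + y) = a *: f x + f y) ->
  exists F : {linear U -> V}, forall x, F x = f x.
Proof.
move=> Hf; pose m := GRing.isLinear.Build R U V *:%R f Hf.
pose F : {linear U -> V} := HB.pack f m.
by exists F.
Qed.

Lemma lin_comb (R : nzRingType) (U V : lmodType R) (f : {linear U -> V})
  (I : finType) (c : I -> R) (g : I -> U) :
  f (\sum_i c i *: g i) = \sum_i c i *: f (g i).
Proof. by rewrite linear_sum; apply: eq_bigr => i _; rewrite linearZ. Qed.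

(** The universal property of the free module. It gives both the surjection that projectivity splits
    and the maps out of the presentation of M tensor K. *)
Lemma freeg_lift (R : nzRingType) (T : choiceType) (M : lmodType R)
  (f : T -> M) :
  exists F : {linear {freeg T / R} -> M}, forall k x, F << k *g x >> = k *: f x.
Proof.
have fB := @lift_is_additive R T M f.
have f0 : fglift f 0 = 0 by rewrite -(subrr 0) fB subrr.
have fD x y : fglift f (x + y) = fglift f x + fglift f y.
  by rewrite -{1}[y]opprK fB -[- y]sub0r fB f0 sub0r opprK.
have fS (r : seq T) (G : T -> {freeg T / R}) :
    fglift f (\sum_(z <- r) G z) = \sum_(z <- r) fglift f (G z).
  by elim: r => [|z r IH]; rewrite ?big_nil // !big_cons fD IH.
have [a x y|F HF] := @mk_linear R _ M (fglift f); last first.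
  by exists F => k x; rewrite HF liftU.
rewrite fD; congr (_ + _).
rewrite -{2}[x]freeg_sumE [a *: x]/(fgscale a x) /fgscale !fS scaler_sumr.
by apply: eq_bigr => z _; rewrite !liftU scalerA.
Qed.

Section Quotmod.
Variables (R : nzRingType) (V : lmodType R) (S : submodClosed V).

Lemma quotmod_pi : exists p : {linear V -> quotmod S},
  (forall y, exists x, p x = y) /\ (forall x, p x = 0 <-> x \in S).
Proof.
have [|p Hp] := @mk_linear _ _ (quotmod S) (fun v => \pi_(quotmod S) v).
  move=> a x y; rewrite pi_addr; congr (_ + _).
  exact: (esym (quotmod_scale_pi S a x)).
exists p; split=> [y|x]; first by exists (repr y); rewrite Hp reprK.
rewrite Hp -{2}[x]subr0 -[x - 0 \in S]/(x - 0 \in quot_pred S).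
rewrite Quotient.idealrBE; split=> [E|/eqP->]; last by rewrite pi_zeror.
by rewrite E pi_zeror.
Qed.

Lemma submod_mk (x : V) : x \in S -> exists y : submod S, val y = x.
Proof. by move=> xS; exists (Submod xS). Qed.

Lemma submod_val_lin : exists i : {linear submod S -> V}, forall x, i x = val x.
Proof. by apply: mk_linear => a x y; rewrite linearP. Qed.
End Quotmod.

(** * Ideals of a Dedekind domain *)

Section Ideals.
Variable R : idomainType.
Hypothesis hR : dedekind R.

(** [Prop]-valued, since the ideals met below (colons, unions of chains, radicals) are given by
    propositions; [ideal_submod] returns to the boolean form in which [dedekind] is stated. *)
Definition ideal (I : R -> Prop) : Prop :=
  I 0 /\ forall a x y, I x -> I y -> I (a * x + y).

Lemma idealD I x y : ideal I -> I x -> I y -> I (x + y).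
Proof. by case=> _ H Ix Iy; rewrite -[x]mul1r; apply: H. Qed.
Lemma idealM I a x : ideal I -> I x -> I (a * x).
Proof. by case=> I0 H Ix; rewrite -[_ * _]addr0; apply: H. Qed.
Lemma idealN I x : ideal I -> I x -> I (- x).
Proof. by move=> Ii Ix; rewrite -mulN1r; apply: idealM. Qed.
Lemma idealB I x y : ideal I -> I x -> I y -> I (x - y).
Proof. by move=> Ii Ix Iy; apply: idealD => //; apply: idealN. Qed.
Lemma ideal_sum I (T : Type) (r : seq T) (F : T -> R) : ideal I ->
  (forall i, I (F i)) -> I (\sum_(i <- r) F i).
Proof.
move=> Ii H; elim/big_rec: _ => [|i x _ Ix]; first by case: Ii.
exact: idealD.
Qed.

Lemma ideal_submod (I : R -> Prop) : ideal I ->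
  exists S : submodClosed R^o, forall x : R, x \in S <-> I x.
Proof.
case=> I0 Il; pose p : {pred R^o} := fun x => `[< I x >].
have pc : submod_closed p.
  split; first exact/asboolP.
  by move=> a x y /asboolP Ix /asboolP Iy; apply/asboolP/Il.
pose S : submodClosed R^o := HB.pack p (GRing.isSubmodClosed.Build R R^o p pc).
by exists S => x; rewrite -[x \in S]/(`[< I x >] : bool); split=> /asboolP.
Qed.

Lemma submod_ideal (S : submodClosed R^o) : ideal (fun x => x \in S).
Proof. by have [? ?] := GRing.submodClosedP S; split. Qed.

(* The dual basis lemma, in the form I * ((y) : I) = (y). *)
Lemma ideal_inv (I : R -> Prop) (y : R) : ideal I -> I y -> y != 0 ->
  exists n (x a : 'I_n -> R), [/\ forall i, I (x i),
    forall i z, I z -> exists b, a i * z = y * b & \sum_i a i * x i = y].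
Proof.
move=> Ii Iy y0; have [S SE] := ideal_submod Ii.
pose A := {freeg (submod S) / R}.
have [g Hg] := @freeg_lift R (submod S) (submod S) (fun z => z).
have [id' Hid] : exists i : {linear submod S -> submod S}, forall x, i x = x.
  by have [//|i Hi] := @mk_linear R (submod S) (submod S) id; exists i.
have [|h Hh] := @hR S _ _ g id'.
  by move=> b; exists << b >>; rewrite Hg scale1r.
have [yS Hy] := submod_mk (iffRL (SE y) Iy).
(* The x_i are the support of [h yS], and a_i is the coefficient of [h yS] at x_i. As h is linear, y
   h(z) = z h(y), which makes a_i z a multiple of y. *)
pose D := dom (h yS); pose w (i : 'I_(size D)) := tnth (in_tuple D) i.
exists (size D), (fun i => val (w i)), (fun i => coeff (w i) (h yS)); split.
- by move=> i; apply/SE; exact: (valP (w i)).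
- move=> i z Iz; have [zS Hz] := submod_mk (iffRL (SE z) Iz).
  exists (coeff (w i) (h zS)); rewrite -Hz -Hy.
  have E : (val zS : R) *: yS = (val yS : R) *: zS.
    by apply: val_inj; rewrite /= /GRing.scale /= mulrC.
  have := congr1 (fun s => coeff (w i) (h s)) E.
  by rewrite /= !linearZ !coeffZ mulrC.
have <- : val (g (h yS)) = y by rewrite Hh Hid.
rewrite -[h yS in RHS]freeg_sumE linear_sum.
have [v Hv] := submod_val_lin S.
rewrite -[RHS]Hv linear_sum [RHS]big_tnth; apply: eq_bigr => i _.
by rewrite Hg linearZ Hv.
Qed.

(** The x_i of the dual basis generate: y z = \sum (a_i z) x_i = y \sum b_i x_i, and y cancels. *)
Lemma ideal_gen (I : R -> Prop) : ideal I ->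
  exists n (x : 'I_n -> R), (forall i, I (x i)) /\
    forall z, I z -> exists c : 'I_n -> R, z = \sum_i c i * x i.
Proof.
move=> Ii; have [[y [Iy y0]]|H] := pselect (exists y, I y /\ y != 0).
  have [n [x [a [xI aI E]]]] := ideal_inv Ii Iy y0.
  exists n, x; split=> // z Iz.
  have /choice [b Hb] := fun i => aI i z Iz.
  exists b; apply: (mulfI y0); rewrite -{1}E mulr_suml mulr_sumr.
  apply: eq_bigr => i _; rewrite mulrA -Hb; ring.
exists 0%N, (fun=> 0); split=> [[]//|z Iz]; exists (fun=> 0).
rewrite big_ord0; apply/eqP/negP => /negP z0; by apply: H; exists z.
Qed.

Lemma ideal_acc (I : nat -> R -> Prop) : (forall k, ideal (I k)) ->
  (forall k x, I k x -> I k.+1 x) -> exists k, forall x, I k.+1 x -> I k x.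
Proof.
move=> Ii Isub.
have Imon k l x : (k <= l)%N -> I k x -> I l x.
  by move/subnK <-; elim: (l - k)%N => // m IH /IH; rewrite addSn; exact: Isub.
have [|n [x [xI H]]] := @ideal_gen (fun x => exists k, I k x).
  split; first by exists 0%N; case: (Ii 0%N).
  move=> a x y [k xk] [l yl]; exists (maxn k l).
  have [_] := Ii (maxn k l); apply.
    exact: Imon (leq_maxl _ _) xk.
  exact: Imon (leq_maxr _ _) yl.
have /choice [f Hf] := xI.
exists (\max_i f i)%N => z Iz.
have [|c ->] := H z; first by exists (\max_i f i).+1.
apply: ideal_sum => // i; apply: idealM => //.
by apply: Imon (Hf i); exact: leq_bigmax.
Qed.

(** Noetherian induction: from a counterexample, choice builds an infinite strictly increasing chain
    of counterexamples, against [ideal_acc]. *)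
Lemma ideal_ind (P : (R -> Prop) -> Prop) :
  (forall I, ideal I ->
     (forall J, ideal J -> (forall x, I x -> J x) ->
        (exists2 x, J x & ~ I x) -> P J) -> P I) ->
  forall I, ideal I -> P I.
Proof.
move=> H I Ii; apply: contrapT => nPI.
pose T := {I : R -> Prop | ideal I /\ ~ P I}.
pose S (A B : T) := (forall x, sval A x -> sval B x) /\
  exists2 x, sval B x & ~ sval A x.
have HS (A : T) : exists B, S A B.
  case: A => A [Ai nPA]; apply: contrapT => nB; apply: (nPA).
  apply: H => // J Ji AJ JA.
  by apply: contrapT => nPJ; apply: nB; exists (exist _ J (conj Ji nPJ)).
have /choice [f Hf] := HS.
pose F k := iter k f (exist _ I (conj Ii nPI) : T).
have [k||k Hk] := @ideal_acc (fun k => sval (F k)).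
- by have [] := svalP (F k).
- by move=> k; have [] := Hf (F k).
by have [_ [x xB nA]] := Hf (F k); apply: nA; exact: Hk.
Qed.

Lemma ideal_colon (J : R -> Prop) e : ideal J -> ideal (fun x => J (x * e)).
Proof.
move=> Ji; split; first by rewrite mul0r; case: Ji.
move=> a x y Jx Jy; rewrite mulrDl -mulrA.
by apply: idealD => //; apply: idealM.
Qed.

(* R/J satisfies the descending chain condition: inclusion is reversed by
   I |-> (a) : I, for a nonzero a in J. *)
Lemma pow_stable (J : R -> Prop) (u : R) : ideal J ->
  (exists2 a, J a & a != 0) ->
  exists k v, J (u ^+ k.+1 * (1 - u * v)).
Proof.
move=> Ji [a Ja a0].
pose A k x := (exists b, x * u ^+ k.+1 = a * b) /\
  (forall j, J j -> exists b, x * j = a * b).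
have [k|k x [[b Hb] xJ]|k Hk] := @ideal_acc A.
- split=> [|c x y [[b Hb] xJ] [[d Hd] yJ]].
    by split=> [|j _]; exists 0; rewrite mul0r mulr0.
  split=> [|j Jj].
    by exists (c * b + d); rewrite mulrDl -mulrA Hb Hd; ring.
  have [b' Hb'] := xJ _ Jj; have [d' Hd'] := yJ _ Jj.
  by exists (c * b' + d'); rewrite mulrDl -mulrA Hb' Hd'; ring.
- by split=> //; exists (b * u); rewrite exprSr mulrA Hb mulrA.
pose I x := exists c j, J j /\ x = u ^+ k.+2 * c + j.
have Ii : ideal I.
  split; first by exists 0, 0; split; [case: Ji|rewrite mulr0 addr0].
  move=> r x y [c [j [Jj ->]]] [d [l [Jl ->]]].
  exists (r * c + d), (r * j + l); split; last by ring.
  by case: Ji => _; apply.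
have Ia : I a by exists 0, a; split=> //; rewrite mulr0 add0r.
(* Each b_i multiplies I = (u^(k+2)) + J into (a), so it lies in [A k.+1], hence in [A k]: b_i
   u^(k+1) = a c_i. Therefore u^(k+1) = \sum c_i x_i lies in I. *)
have [n [x [b [xI bI E]]]] := ideal_inv Ii Ia a0.
have /choice [c Hc] : forall i, exists c, b i * u ^+ k.+1 = a * c.
  move=> i; suff [] : A k (b i) by [].
  apply: Hk; split=> [|j Jj]; apply: bI.
    by exists 1, 0; split; [case: Ji|rewrite mulr1 addr0].
  by exists 0, j; split=> //; rewrite mulr0 add0r.
have : I (u ^+ k.+1).
  have -> : u ^+ k.+1 = \sum_i c i * x i.
    apply: (mulfI a0); rewrite -{1}E mulr_suml mulr_sumr; apply: eq_bigr => i _.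
    by rewrite mulrA -Hc; ring.
  by apply: ideal_sum => // i; apply: idealM.
move=> [v [j [Jj Ej]]]; exists k, v.
suff -> : u ^+ k.+1 * (1 - u * v) = j by [].
rewrite mulrBr mulr1 {1}Ej (exprSr u k.+1); ring.
Qed.

(* e is a "primary idempotent" for J at m: R/(J : e) is local with maximal
   ideal the image of m, which is nilpotent elementwise. *)
Definition loc_at (J m : R -> Prop) (e : R) : Prop :=
  [/\ ~ J e, forall u, ~ m u -> exists v, J (e * (1 - u * v)) &
      forall u, m u <-> exists k, J (e * u ^+ k)].

(* A substitute for primary decomposition: as R/J is artinian, splitting off
   idempotents modulo J ends at elements e with R/(J : e) local. *)
Lemma ded_ind (J : R -> Prop) (P : R -> Prop) : ideal J ->
  (exists2 a, J a & a != 0) -> (forall e, J e -> P e) ->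
  (forall m e, loc_at J m e -> P e) ->
  (forall b c e, b + c = 1 -> J (e * b * c) -> P (e * b) -> P (e * c) -> P e) ->
  P 1.
Proof.
move=> Ji [a Ja a0] P0 Ploc Psplit.
(* Noetherian induction on the colon ideal I = J : e. *)
suff H I : ideal I -> forall e, (forall x, I x <-> J (x * e)) -> P e.
  by apply: (H (fun x => J (x * 1))) => //; exact: ideal_colon.
move=> Ii; elim/ideal_ind: I / Ii => I Ii IH e IE.
have [Je|nJe] := pselect (J e); first exact: P0.
have [[b [c [bc1 [Jebc [neb nec]]]]]|nbc] := pselect (exists b c, b + c = 1 /\
    J (e * b * c) /\ ~ J (e * b) /\ ~ J (e * c)).
  (* Passing from e to e b' strictly enlarges the colon ideal: c' enters it. *)
  have Q b' c' : b' + c' = 1 -> J (e * b' * c') -> ~ J (e * c') -> P (e * b').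
    move=> E1 J1 J2; apply: (IH (fun x => J (x * (e * b')))) => //.
    - exact: ideal_colon.
    - move=> x /IE; rewrite mulrA [_ * b']mulrC; exact: idealM.
    - exists c'; first by rewrite mulrC.
      by move/IE; rewrite mulrC.
  apply: (Psplit b c) => //; first exact: (Q b c).
  by apply: (Q c b) => //; rewrite 1?addrC // mulrAC.
pose m u := exists k, J (e * u ^+ k).
apply: (Ploc m); split=> // u nmu.
have [|k [v Hv]] := @pow_stable I u Ii.
  by exists a => //; apply/IE; rewrite mulrC; apply: idealM.
move/IE: Hv => Hv.
(* c = (u v)^(k+1) is idempotent modulo J : e *)
pose c := (u * v) ^+ k.+1.
have Jd l : J (e * u ^+ k.+1 * (1 - (u * v) ^+ l)).
  elim: l => [|l IHl]; first by rewrite expr0 subrr mulr0; case: Ji.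
  have -> : e * u ^+ k.+1 * (1 - (u * v) ^+ l.+1) =
    (u * v) * (e * u ^+ k.+1 * (1 - (u * v) ^+ l)) +
    u ^+ k.+1 * (1 - u * v) * e.
    by rewrite [(u * v) ^+ l.+1]exprS; ring.
  by apply: idealD => //; apply: idealM.
have Jbc : J (e * (1 - c) * c).
  have -> : e * (1 - c) * c = v ^+ k.+1 * (e * u ^+ k.+1 * (1 - c)).
    by rewrite {2}/c exprMn; ring.
  by apply: idealM => //; apply: Jd.
(* As nothing splits e, either 1 - c or c lies in J : e. In the first case u^k v^(k+1) inverts u; in
   the second u is nilpotent, which is excluded. *)
have [Jb|nJb] := pselect (J (e * (1 - c))).
  by exists (u ^+ k * v ^+ k.+1); rewrite mulrA -exprS -exprMn.
have [Jc|nJc] := pselect (J (e * c)).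
  case: nmu; exists k.+1.
  have -> : e * u ^+ k.+1 = e * u ^+ k.+1 * (1 - c) + u ^+ k.+1 * (e * c).
    by ring.
  by apply: idealD => //; [exact: (Jd k.+1)|exact: idealM].
by case: nbc; exists (1 - c), c; rewrite subrK.
Qed.

Lemma loc_at_ideal J m e : ideal J -> loc_at J m e -> ideal m.
Proof.
move=> Ji [_ _ mE]; split.
  by apply/mE; exists 1%N; rewrite expr1 mulr0; case: Ji.
move=> a x y /mE [k Hk] /mE [l Hl]; apply/mE; exists (k + l)%N.
rewrite exprDn mulr_sumr; apply: ideal_sum => // i.
rewrite mulrnAr -mulr_natl; apply: idealM => //.
have [il|li] := leqP l i.
  have -> : e * ((a * x) ^+ (k + l - i) * y ^+ i) =
     ((a * x) ^+ (k + l - i) * y ^+ (i - l)) * (e * y ^+ l).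
    have := exprD y (i - l) l; rewrite subnK // => ->; ring.
  exact: idealM.
have kE : (k + l - i = k + (l - i))%N by rewrite addnBA // ltnW.
have -> : e * ((a * x) ^+ (k + l - i) * y ^+ i) =
     (a ^+ (k + (l - i)) * x ^+ (l - i) * y ^+ i) * (e * x ^+ k).
  by rewrite kE exprMn !exprD; ring.
exact: idealM.
Qed.

(** A unit is not nilpotent: with u v = 1 modulo J : e, the relation J (e u^(k+1)) descends to J (e
    u^k), and finally to J e. *)
Lemma loc_at_notin J m e u : ideal J -> loc_at J m e ->
  (exists v, J (e * (1 - u * v))) -> ~ m u.
Proof.
move=> Ji [nJe mU mE] [v Hv] /mE[k Hk]; apply: nJe.
elim: k Hk => [|k IH]; first by rewrite expr0 mulr1.
move=> Hk; apply: IH.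
have -> : e * u ^+ k = u ^+ k * (e * (1 - u * v)) + v * (e * u ^+ k.+1).
  by rewrite exprS; ring.
by apply: idealD => //; apply: idealM.
Qed.

(** The complement of m consists of units modulo J : e, so it is multiplicative; m is nonzero
    because it contains J. *)
Lemma loc_at_prime J m e : ideal J -> loc_at J m e ->
  (exists2 a, J a & a != 0) ->
  exists p : prime_idealr R, (forall x, x \in p <-> m x) /\ ~ (p =i pred1 0).
Proof.
move=> Ji Jm [a Ja a0]; have mi := loc_at_ideal Ji Jm.
have [nJe mU mE] := Jm.
have n1 : ~ m 1.
  by apply: (loc_at_notin Ji Jm); exists 1; rewrite mulr1 subrr mulr0; case: Ji.
pose q : {pred R} := fun x => `[< m x >].
have qE x : (x \in q) <-> m x by split=> [/asboolP|?] //; apply/asboolP.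
have qi : idealr_closed q.
  split; first by apply/qE; case: mi.
    by apply/negP => /qE.
  by move=> b x y /qE ? /qE ?; apply/qE; case: mi => _; apply.
have qp : prime_idealr_closed q.
  move=> u v /qE muv; apply/orP.
  have [mu|nmu] := pselect (m u); first by left; apply/qE.
  right; apply/qE; apply: contrapT => nmv.
  have [x Hx] := mU _ nmu; have [y Hy] := mU _ nmv.
  apply: (loc_at_notin Ji Jm) muv; exists (x * y).
  have -> : e * (1 - u * v * (x * y)) =
     e * (1 - u * x) + (u * x) * (e * (1 - v * y)) by ring.
  by apply: idealD => //; apply: idealM.
pose p : prime_idealr R := HB.pack (q : R -> bool)
  (isIdealr.Build R q qi) (isPrimeIdealrClosed.Build R q qp).
exists p; split=> [x|p0]; first exact: qE.
have : a \in p.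
  by apply/qE/mE; exists 1%N; rewrite expr1; apply: idealM.
by rewrite p0 inE (negPf a0).
Qed.
End Ideals.

(** * Isomorphisms *)

Section Iso.
Variable R : nzRingType.

Lemma mk_iso (U V : lmodType R) (f : U -> V) :
  (forall a x y, f (a *: x + y) = a *: f x + f y) ->
  (forall x, f x = 0 -> x = 0) -> (forall y, exists x, f x = y) -> iso_mod U V.
Proof.
move=> /mk_linear[F HF] f0 fs; exists F.
have Fi : injective F.
  move=> x y E; apply/eqP; rewrite -subr_eq0; apply/eqP/f0.
  by rewrite -HF linearB E subrr.
have /choice[g Hg] := fs.
have FK : cancel g F by move=> y; rewrite HF.
by exists g => // x; apply: Fi; rewrite FK.
Qed.

Lemma iso_lin (U V : lmodType R) : iso_mod U V ->
  exists (f : {linear U -> V}) (g : {linear V -> U}), cancel f g /\ cancel g f.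
Proof.
case=> f [g fK gK]; exists f.
have [|G HG] := @mk_linear R V U g.
  by move=> a x y; apply: (can_inj fK); rewrite linearP !gK.
by exists G; split=> x; rewrite HG.
Qed.

Lemma iso_refl (U : lmodType R) : iso_mod U U.
Proof. by apply: (@mk_iso U U id) => // y; exists y. Qed.

Lemma iso_sym (U V : lmodType R) : iso_mod U V -> iso_mod V U.
Proof.
move=> /iso_lin [f [g [fK gK]]]; exists g; by exists f.
Qed.

Lemma iso_trans (V U W : lmodType R) :
  iso_mod U V -> iso_mod V W -> iso_mod U W.
Proof.
move=> /iso_lin [f [f' [fK fK']]] /iso_lin [g [g' [gK gK']]].
apply: (@mk_iso _ _ (fun x => g (f x))) => [a x y|x E|y].
- by rewrite !linearP.
- by rewrite -[x]fK -[f x]gK E !linear0.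
by exists (f' (g' y)); rewrite fK' gK'.
Qed.

Lemma iso_prod (U V U' V' : lmodType R) : iso_mod U U' -> iso_mod V V' ->
  iso_mod (U * V)%type (U' * V')%type.
Proof.
move=> /iso_lin [f [f' [fK fK']]] /iso_lin [g [g' [gK gK']]].
apply: (@mk_iso (U * V)%type (U' * V')%type (fun x => (f x.1, g x.2)))
    => [a x y|[x y] [E F]|[x y]].
- by rewrite !linearP.
- by congr (_, _) => /=; [rewrite -[x]fK E linear0|rewrite -[y]gK F linear0].
by exists (f' x, g' y); rewrite /= fK' gK'.
Qed.

Lemma iso_prodA (U V W : lmodType R) :
  iso_mod (U * (V * W))%type ((U * V) * W)%type.
Proof.
apply: (@mk_iso (U * (V * W))%type ((U * V) * W)%type
         (fun x => ((x.1, x.2.1), x.2.2))) => //.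
- by move=> [x [y z]] /= [-> -> ->].
by move=> [[x y] z]; exists (x, (y, z)).
Qed.

Lemma iso_prodC (U V : lmodType R) : iso_mod (U * V)%type (V * U)%type.
Proof.
apply: (@mk_iso (U * V)%type (V * U)%type (fun x => (x.2, x.1))) => //.
- by move=> [x y] /= [-> ->].
by move=> [x y]; exists (y, x).
Qed.

Lemma iso_prodACA (U V W X : lmodType R) :
  iso_mod ((U * V) * (W * X))%type ((U * W) * (V * X))%type.
Proof.
apply: (@mk_iso ((U * V) * (W * X))%type ((U * W) * (V * X))%type
         (fun x => ((x.1.1, x.2.1), (x.1.2, x.2.2)))) => //.
- by move=> [[x y] [z w]] /= [-> -> -> ->].
by move=> [[x z] [y w]]; exists ((x, y), (z, w)).
Qed.

Lemma iso_ffunD (V : lmodType R) m n :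
  iso_mod ({ffun 'I_m -> V} * {ffun 'I_n -> V})%type {ffun 'I_(m + n) -> V}.
Proof.
apply: iso_sym; apply: (@mk_iso {ffun 'I_(m + n) -> V}
  ({ffun 'I_m -> V} * {ffun 'I_n -> V})%type
  (fun f => ([ffun i => f (lshift n i)], [ffun i => f (rshift m i)]))).
- by move=> a f g; congr (_, _); apply/ffunP => i; rewrite !ffunE.
- move=> f [/ffunP E /ffunP F]; apply/ffunP => i; rewrite ffunE.
  case: (split_ordP i) => j ->; first by have := E j; rewrite !ffunE.
  by have := F j; rewrite !ffunE.
move=> [f g].
exists [ffun i => match split i with inl j => f j | inr j => g j end].
congr (_, _); apply/ffunP => i; rewrite !ffunE.
  by have := unsplitK (inl i : 'I_m + 'I_n) => /= ->.
by have := unsplitK (inr i : 'I_m + 'I_n) => /= ->.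
Qed.

Lemma iso_ffun1 (V : lmodType R) : iso_mod {ffun 'I_1 -> V} V.
Proof.
apply: (@mk_iso {ffun 'I_1 -> V} V (fun f => f 0)).
- by move=> a f g; rewrite !ffunE.
- by move=> f E; apply/ffunP => i; rewrite ord1 E ffunE.
by move=> y; exists [ffun=> y]; rewrite ffunE.
Qed.

End Iso.

(** * Sums of ideals *)

Lemma regZ (R : nzRingType) (a : R) (x : R^o) : a *: x = a * x :> R.
Proof. by []. Qed.

Section IdealSum.
Variable R : idomainType.
Hypothesis hR : dedekind R.
Implicit Types I J : submodClosed R^o.

Definition nonzero I := exists2 a : R, a \in I & a != 0.

Definition iprod I J : submodClosed R^o :=
  gen_submod (fun z : R^o => exists x y : R, [/\ x \in I, y \in J & z = x * y]).

Lemma mem_iprod I J (x y : R) : x \in I -> y \in J -> x * y \in iprod I J.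
Proof. by move=> xI yJ; apply: sub_gen_submod; exists x, y. Qed.

Lemma iprod_min I J (S : R -> Prop) : ideal S ->
  (forall x y : R, x \in I -> y \in J -> S (x * y)) ->
  forall z : R, z \in iprod I J -> S z.
Proof.
move=> /ideal_submod[T HT] H z zIJ; apply/HT.
apply: (@gen_submod_min _ _ _ T (GRing.submodClosedP T) _ z zIJ).
by move=> _ [x [y [xI yJ ->]]]; apply/HT/H.
Qed.

Lemma iprod_nonzero I J : nonzero I -> nonzero J -> nonzero (iprod I J).
Proof.
move=> [x xI x0] [y yJ y0]; exists (x * y); last by rewrite mulf_neq0.
exact: mem_iprod.
Qed.

(** Both sides are f applied to z w = w z: a functional on an ideal is multiplication by a
    fraction. *)
Lemma hom_comm I (f : {linear submod I -> R^o}) (z w : submod I) :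
  (f z : R) * val w = (f w : R) * val z.
Proof.
have E : (val z : R) *: w = (val w : R) *: z.
  by apply: val_inj; rewrite /= /GRing.scale /= mulrC.
have := congr1 f E; rewrite !linearZ /= !regZ => E'.
by rewrite mulrC -E' mulrC.
Qed.

(** The functional f_i is multiplication by the fraction a_i / y, with a_i from [ideal_inv]; this is
    I times its inverse equal to R. *)
Lemma ideal_dual I : nonzero I ->
  exists n (x : 'I_n -> submod I) (f : 'I_n -> {linear submod I -> R^o}),
    \sum_i (f i (x i) : R) = 1.
Proof.
move=> [y yI y0].
have [n [x [a [xI aI E]]]] := ideal_inv hR (submod_ideal I) yI y0.
have /choice [b Hb] : forall i, exists f : {linear submod I -> R^o},
    forall z : submod I, a i * val z = y * f z.
  move=> i.
  have /choice [f Hf] : forall z : submod I, exists b, a i * val z = y * b.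
    by move=> z; apply: aI; exact: (valP z).
  have [|F HF] := @mk_linear R (submod I) R^o f.
    move=> c u v; apply: (mulfI y0).
    change (y * f (c *: u + v) = y * (c * f u + f v)).
    rewrite -Hf [RHS]mulrDr -Hf mulrCA -Hf /= ?regZ; ring.
  by exists F => z; rewrite HF.
exists n, (fun i => Submod (xI i)), b; apply: (mulfI y0).
by rewrite mulr_sumr mulr1 -[RHS]E; apply: eq_bigr => i _; rewrite -Hb.
Qed.

Lemma ideal_hom_notin I (m : R -> Prop) : nonzero I -> ideal m -> ~ m 1 ->
  exists (f : {linear submod I -> R^o}) (x : submod I), ~ m (f x).
Proof.
move=> /ideal_dual [n [x [f E]]] mi m1; apply: contrapT => H; apply: m1.
rewrite -E; apply: ideal_sum => // i; apply: contrapT => nm.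
by apply: H; exists (f i), (x i).
Qed.

(** On each local factor of R/J, [ideal_hom_notin] gives a functional with a unit value, which
    rescaling x turns into 1. Two such solutions f, g glue to b f + c g, since the cross terms carry
    the factor e b c, which lies in J. *)
Lemma ideal_hom_coprime I J : nonzero I -> nonzero J ->
  exists (f : {linear submod I -> R^o}) (x : submod I),
    (1 - (f x : R) : R) \in J.
Proof.
move=> I0 J0; have Ji := submod_ideal J.
pose P (e : R) := exists (f : {linear submod I -> R^o}) (x : submod I),
  (e * (1 - (f x : R)) : R) \in J.
suff [f [x]] : P 1 by rewrite mul1r => H; exists f, x.
have [f0 H0] : exists f : {linear submod I -> R^o}, forall x, f x = 0.
  by apply: mk_linear => a x y; rewrite scaler0 addr0.
apply: (ded_ind hR Ji J0) => [e Je|m e em|b c e bc Jebc [f [x Hf]] [g [y Hg]]].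
- by exists f0, 0; rewrite mulrC; apply: (idealM _ Ji).
- have mi := loc_at_ideal Ji em.
  have [|f [x nm]] := ideal_hom_notin I0 mi.
    apply: (loc_at_notin Ji em); exists 1; rewrite mulr1 subrr mulr0.
    by case: Ji.
  case: em => _ mU _; have [v Hv] := mU _ nm.
  by exists f, (v *: x); rewrite linearZ /= regZ [v * _]mulrC.
have [|h Hh] := @mk_linear R (submod I) R^o (fun z => b *: f z + c *: g z).
  move=> a u v; rewrite (linearP f) (linearP g) !regZ; ring.
exists h, (b *: x + c *: y).
(* Expand 1 as (b + c)^2 = b^2 + 2 b c + c^2 and match it with the four terms of h (b x + c y). *)
have -> : e * (1 - (h (b *: x + c *: y) : R)) =
   b * (e * b * (1 - (f x : R))) + c * (e * c * (1 - (g y : R))) +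
   (2%:R - (f y : R) - (g x : R)) * (e * b * c).
  rewrite Hh (linearP f) (linearP g) !linearZ /= !regZ.
  have -> : c = 1 - b by rewrite -bc addrAC subrr add0r.
  ring.
do 2?[apply: (idealD Ji)]; exact: (idealM _ Ji).
Qed.

(* If f : I -> R and a in I satisfy f a = 1 modulo J, then (x, y) |-> f x + y is
   onto R, with kernel {x in I | f x in J} = IJ. *)
Lemma iso_ideal_sum I J : nonzero I -> nonzero J ->
  iso_mod (submod I * submod J)%type (R^o * submod (iprod I J))%type.
Proof.
move=> I0 J0; have [f [a Ja]] := ideal_hom_coprime I0 J0.
pose r (z : submod I * submod J) : R := f z.1 + val z.2.
have Ii := submod_ideal I; have Ji := submod_ideal J.
(* The pair (a, 1 - f a) is sent to 1 by r. Subtracting r(x, y) times this pair projects (x, y) to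
   the kernel, and x - r a is the first coordinate of the result. *)
have rP z : val z.1 - r z * val a \in iprod I J.
  have E : (val z.1 - r z * val a : R) = val z.1 * (1 - f a) - val a * val z.2.
    by rewrite /r mulrDl (hom_comm f); ring.
  rewrite E; apply: (idealB (submod_ideal _)); apply: mem_iprod => //;
    exact: valP.
apply: (@mk_iso _ (submod I * submod J)%type (R^o * submod (iprod I J))%type
  (fun z => (r z, Submod (rP z)))).
- move=> c x y; congr (_, _); last apply: val_inj.
  + rewrite /r /= linearP !regZ; ring.
  rewrite /= /r /= linearP !regZ; ring.
- move=> [x y] H; have E : r (x, y) = 0 := congr1 fst H.
  have : val x - r (x, y) * val a = 0 := congr1 (fun w => val w.2) H.
  rewrite E mul0r subr0 => x0.
  have {}x0 : x = 0 by apply: val_inj.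
  move: E; rewrite /r /= x0 linear0 add0r => y0.
  by congr (_, _); apply: val_inj.
move=> [c z].
have zI : val z \in I.
  apply: (@iprod_min I J (fun u => u \in I) Ii _ (val z) (valP z)).
  by move=> u v uI vJ; rewrite mulrC; apply: (idealM _ Ii).
have fzJ : f (Submod zI) \in J.
  have : exists2 u : submod I, val u = val z & f u \in J.
    apply: (@iprod_min I J
      (fun w => exists2 u : submod I, val u = w & f u \in J)
      _ _ (val z) (valP z)).
      split=> [|d _ _ [u <- fu] [v <- fv]].
        by exists 0; rewrite ?linear0 ?rpred0.
      by exists (d *: u + v) => //; rewrite linearP; case: Ji => _; apply.
    move=> u v uI vJ; exists (v *: Submod uI); first by rewrite mulrC.
    by rewrite linearZ /= regZ mulrC; apply: (idealM _ Ji).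
  by case=> u E; have -> : u = Submod zI by apply: val_inj.
pose x : submod I := c *: a + Submod zI.
have yJ : c * (1 - f a) - f (Submod zI) \in J.
  by apply: (idealB Ji) => //; apply: (idealM _ Ji).
exists (x, Submod yJ).
have rE : r (x, Submod yJ) = c.
  by rewrite /r /x /= linearP !regZ; ring.
congr (_, _) => //; apply: val_inj; rewrite /= rE /x /= ?regZ; ring.
Qed.

End IdealSum.

(** * Rank *)

Lemma lin_comp (R : nzRingType) (U V W : lmodType R)
  (g : {linear V -> W}) (f : {linear U -> V}) :
  exists h : {linear U -> W}, forall x, h x = g (f x).
Proof.
have [|h Hh] := @mk_linear R U W (fun x => g (f x)); last by exists h.
by move=> a x y; rewrite (linearP f) (linearP g).
Qed.

Definition kerp (R : nzRingType) (U V : lmodType R) (f : {linear U -> V}) :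
  {pred U} := fun x => f x == 0.

Lemma kerp_closed (R : nzRingType) (U V : lmodType R) (f : {linear U -> V}) :
  submod_closed (kerp f).
Proof.
split=> [|a x y]; first by rewrite unfold_in /= linear0.
by rewrite !unfold_in /= linearP => /eqP-> /eqP->; rewrite scaler0 addr0.
Qed.
HB.instance Definition _ (R : nzRingType) (U V : lmodType R)
    (f : {linear U -> V}) :=
  GRing.isSubmodClosed.Build R U (kerp f) (kerp_closed f).

Lemma mem_kerp (R : nzRingType) (U V : lmodType R) (f : {linear U -> V}) x :
  (x \in kerp f) = (f x == 0).
Proof. by []. Qed.

Section Rank.
Variable R : idomainType.
Implicit Types M N A F : lmodType R.

Definition lin_indep M (I : finType) (b : I -> M) :=
  forall c : I -> R, \sum_i c i *: b i = 0 -> forall i, c i = 0.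

(* x lies in the K-span of b, once torsion is ignored. *)
Definition qspan M (I : finType) (b : I -> M) (x : M) :=
  exists a (c : I -> R), a != 0 /\ a *: x = \sum_i c i *: b i.

(** Rank expressed inside M, by an independent family with torsion cokernel; [rankE] identifies it
    with the dimension of M tensor K. *)
Definition has_rank M n := exists b : 'I_n -> M,
  lin_indep b /\ forall x, qspan b x.

Section Qspan.
Variables (M : lmodType R) (I : finType) (b : I -> M).

Lemma qspan_lin a x y : qspan b x -> qspan b y -> qspan b (a *: x + y).
Proof.
move=> [d [c [d0 E]]] [d' [c' [d'0 E']]].
exists (d * d'), (fun i => d' * a * c i + d * c' i).
split; first by rewrite mulf_neq0.
rewrite scalerDr scalerA [d * d' * a]mulrAC mulrC -[d * a]mulrC.
rewrite mulrA -[(d' * a * d) *: x]scalerA E -[(d * d') *: y]scalerA E'.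
rewrite !scaler_sumr -big_split; apply: eq_bigr => i _ /=.
by rewrite !scalerA scalerDl.
Qed.

Lemma qspan0 : qspan b 0.
Proof.
exists 1, (fun=> 0); split; first exact: oner_neq0.
by rewrite scaler0 big1 // => i _; rewrite scale0r.
Qed.

Lemma qspan_sum (J : finType) (c : J -> R) (x : J -> M) :
  (forall j, qspan b (x j)) -> qspan b (\sum_j c j *: x j).
Proof.
move=> H; elim/big_rec: _ => [|j y _]; [exact: qspan0|exact: qspan_lin].
Qed.

Lemma qspan_div a x : a != 0 -> qspan b (a *: x) -> qspan b x.
Proof.
move=> a0 [d [c [d0 E]]]; exists (d * a), c; split; first by rewrite mulf_neq0.
by rewrite -scalerA.
Qed.

Lemma qspan_base i : qspan b (b i).
Proof.
exists 1, (fun j => (j == i)%:R); split; first exact: oner_neq0.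
rewrite (bigD1 i) //= eqxx big1 ?addr0 // => j /negPf->; exact: scale0r.
Qed.

Lemma qspan_trans (J : finType) (d : J -> M) x :
  (forall j, qspan b (d j)) -> qspan d x -> qspan b x.
Proof.
by move=> H [a [c [a0 E]]]; apply: (qspan_div a0); rewrite E; exact: qspan_sum.
Qed.
End Qspan.

Lemma has_rank_fin M (I : finType) (b : I -> M) : lin_indep b ->
  (forall x, qspan b x) -> has_rank M #|I|.
Proof.
move=> bi bs; exists (fun i => b (enum_val i)).
have E (c : 'I_#|I| -> R) : \sum_i c i *: b (enum_val i) =
    \sum_(j : I) c (enum_rank j) *: b j.
  rewrite (reindex enum_rank) /=; last by apply: onW_bij; apply: enum_rank_bij.
  by apply: eq_bigr => i _; rewrite enum_rankK.
split=> [c|x].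
  by rewrite E => /bi H i; rewrite -(enum_valK i); exact: H.
have [a [c [a0 H]]] := bs x; exists a, (fun i => c (enum_val i)); split=> //.
by rewrite E H; apply: eq_bigr => i _; rewrite enum_rankK.
Qed.

Lemma has_rank_torsion M : (forall x, x \in @Tor_pred _ M) -> has_rank M 0.
Proof.
move=> H; exists (fun=> 0); split=> [c _ []//|x].
have /asboolP[a a0 E] := H x.
by exists a, (fun=> 0); rewrite big_ord0.
Qed.

Lemma fin_gen_rank M : fin_gen M -> exists n, has_rank M n.
Proof.
move=> [k [g Hg]].
suff [n [b [bi bs]]] : exists n (b : 'I_n -> M),
    lin_indep b /\ forall j, qspan b (g j).
  exists n, b; split=> // x; have [c ->] := Hg x; exact: qspan_sum.
move: k g {Hg}; elim=> [|k IH] g.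
  by exists 0%N, (fun=> 0); split=> [c _ []//|[]//].
have [n [b [bi bs]]] := IH (fun i => g (lift ord_max i)).
have sE (c : 'I_n.+1 -> R) (y : M) :
  \sum_i c i *: (if unlift ord_max i is Some j then b j else y) =
  \sum_i c (lift ord_max i) *: b i + c ord_max *: y.
  rewrite big_ord_recr /= unlift_none; congr (_ + _); apply: eq_bigr => i _.
  have -> : widen_ord (leqnSn n) i = lift ord_max i.
    by apply: val_inj; rewrite /= /bump leqNgt ltn_ord.
  by rewrite liftK.
have [gs|ngs] := pselect (qspan b (g ord_max)).
  exists n, b; split=> // j; case: (unliftP ord_max j) => [i|] -> //; exact: bs.
exists n.+1, (fun i => if unlift ord_max i is Some j then b j else g ord_max).
split.
  move=> c; rewrite sE => E.
  have c0 : c ord_max = 0.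
    apply/eqP/negP => /negP cn; apply: ngs.
    exists (c ord_max), (fun i => - c (lift ord_max i)); split=> //.
    apply/eqP; rewrite -subr_eq0 -sumrN addrC -[X in _ == X]E; apply/eqP.
    congr (_ + _); apply: eq_bigr => i _; by rewrite scaleNr opprK.
  move: E; rewrite c0 scale0r addr0 => /bi H i.
  by case: (unliftP ord_max i) => [j|] ->.
set b' := fun i => _.
have bb' i : qspan b' (b i).
  by have := qspan_base b' (lift ord_max i); rewrite /b' liftK.
move=> j; case: (unliftP ord_max j) => [i|] ->.
  exact: qspan_trans bb' (bs i).
by have := qspan_base b' ord_max; rewrite /b' unlift_none.
Qed.

(** The hypotheses say that 0 -> A -> M -> F -> 0 becomes exact over K. A basis of A together with
    lifts of nonzero multiples of a basis of F is a basis of M. *)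
Lemma has_rankD A M F (i : {linear A -> M}) (g : {linear M -> F}) p q :
  (forall y, i y = 0 -> y \in @Tor_pred _ A) -> (forall y, g (i y) = 0) ->
  (forall x, g x = 0 -> exists a y, a != 0 /\ a *: x = i y) ->
  (forall y, exists a x, a != 0 /\ a *: y = g x) ->
  has_rank A p -> has_rank F q -> has_rank M (p + q).
Proof.
move=> iT gi gE gS [b [bi bs]] [c [ci cs]].
have /choice [a /choice [d Hd]] := fun j => gS (c j).
pose e (k : 'I_p + 'I_q) := match k with inl k => i (b k) | inr j => d j end.
have eE (x : 'I_p + 'I_q -> R) : \sum_k x k *: e k =
    i (\sum_k x (inl k) *: b k) + \sum_j x (inr j) *: d j.
  by rewrite big_sumType lin_comb.
have <- : #|{: 'I_p + 'I_q}| = (p + q)%N by rewrite card_sum !card_ord.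
apply: (@has_rank_fin _ _ e) => [x|x].
  rewrite eE => E.
  have r0 j : x (inr j) = 0.
    have := congr1 g E; rewrite linearD gi add0r lin_comb linear0.
    under eq_bigr => k _ do rewrite -(Hd k).2 scalerA.
    move/ci/(_ j)/eqP; rewrite mulf_eq0 (negPf (Hd j).1) orbF => /eqP //.
  move: E; rewrite [X in _ + X]big1 => [|j _]; last by rewrite r0 scale0r.
  rewrite addr0 => /iT/asboolP[s s0 E] [k|//].
  apply: (mulfI s0); rewrite mulr0; move: k.
  apply: (bi (fun k => s * x (inl k))).
  rewrite -[RHS]E scaler_sumr; apply: eq_bigr => k _.
  by rewrite scalerA.
have [s [z [s0 Hz]]] : qspan (fun j => g (d j)) (g x).
  apply: qspan_trans (cs (g x)) => j; apply: (qspan_div (Hd j).1).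
  rewrite (Hd j).2; exact: (qspan_base (fun j => g (d j))).
have [|s' [y [s'0 Hy]]] := gE (s *: x - \sum_j z j *: d j).
  by rewrite linearB linearZ /= lin_comb Hz subrr.
apply: (qspan_div s0); rewrite -[s *: x](subrK (\sum_j z j *: d j)).
rewrite -[X in X + _]scale1r; apply: qspan_lin; last first.
  by apply: qspan_sum => j; exact: (qspan_base e (inr j)).
apply: (qspan_div s'0); rewrite Hy.
have [r [w [r0 Hw]]] := bs y; apply: (qspan_div r0).
rewrite -linearZ Hw lin_comb; apply: qspan_sum => k.
exact: (qspan_base e (inl k)).
Qed.

Lemma has_rank_quo M F (g : {linear M -> F}) n :
  (forall x, g x = 0 -> x \in @Tor_pred _ M) ->
  (forall y, exists a x, a != 0 /\ a *: y = g x) ->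
  has_rank F n -> has_rank M n.
Proof.
move=> gT gS Fn; have [p [pS pE]] := quotmod_pi (kerp g).
have [i Hi] := submod_val_lin (kerp g).
apply: (@has_rankD _ M F i g 0 n) => //.
- move=> y; rewrite Hi => y0; apply/asboolP; exists 1; first exact: oner_neq0.
  by rewrite scale1r; apply: val_inj.
- by move=> y; apply/eqP; rewrite Hi; exact: (valP y).
- move=> x /eqP gx; exists 1, (Submod (gx : x \in kerp g)).
  by rewrite oner_neq0 scale1r Hi.
apply: has_rank_torsion => y; have /eqP/gT/asboolP[a a0 E] := valP y.
by apply/asboolP; exists a => //; apply: val_inj.
Qed.

Lemma has_rank_iso M F n : iso_mod M F -> has_rank F n -> has_rank M n.
Proof.
move=> /iso_lin [f [f' [fK fK']]]; apply: (@has_rank_quo _ _ f).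
  by move=> x E; rewrite -[x]fK E linear0; exact: rpred0.
by move=> y; exists 1, (f' y); rewrite fK' scale1r oner_neq0.
Qed.

Lemma has_rank_prod M N m n : has_rank M m -> has_rank N n ->
  has_rank (M * N)%type (m + n).
Proof.
have [|i Hi] := @mk_linear R M (M * N)%type (fun x => (x, 0)).
  by move=> a x y; congr (_, _); rewrite /= scaler0 addr0.
have [|g Hg] := @mk_linear R (M * N)%type N snd; first by [].
apply: (@has_rankD _ _ _ i g) => [y|y|[x y]|y].
- by rewrite Hi => -[->]; exact: rpred0.
- by rewrite Hg Hi.
- by rewrite Hg /= => ->; exists 1, x; rewrite oner_neq0 scale1r Hi.
by exists 1, (0, y); rewrite oner_neq0 scale1r Hg.
Qed.

Lemma has_rank_ffun M n t : has_rank M n -> has_rank {ffun 'I_t -> M} (t * n).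
Proof.
move=> Mn; elim: t => [|t IH].
  apply: has_rank_torsion => y; apply/asboolP; exists 1; first exact: oner_neq0.
  by apply/ffunP => -[].
rewrite mulSn; apply: (has_rank_iso (iso_sym (iso_ffunD M 1 t))).
apply: has_rank_prod => //; exact: has_rank_iso (iso_ffun1 M) Mn.
Qed.

Lemma has_rank_regular : has_rank R^o 1.
Proof.
exists (fun=> 1); split=> [c|x].
  by rewrite big_ord1 regZ mulr1 => E i; rewrite ord1.
by exists 1, (fun=> x); rewrite oner_neq0 big_ord1 !regZ mulr1 mul1r.
Qed.

Lemma has_rank_ideal (I : submodClosed R^o) :
  nonzero I -> has_rank (submod I) 1.
Proof.
move=> [x xI x0]; have [i Hi] := submod_val_lin I.
apply: (@has_rank_quo _ _ i) has_rank_regular => [y|y].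
  by rewrite Hi => y0; have -> : y = 0; [exact: val_inj|exact: rpred0].
exists x, (y *: Submod xI); split=> //.
by rewrite linearZ Hi !regZ mulrC.
Qed.

Lemma modTor_pi M : exists p : {linear M -> modTor M},
  (forall y, exists x, p x = y) /\ (forall x, p x = 0 <-> x \in @Tor_pred _ M).
Proof. exact: quotmod_pi. Qed.

Lemma has_rank_modTor M n : has_rank M n -> has_rank (modTor M) n.
Proof.
have [p [pS pE]] := modTor_pi M => -[b [bi bs]].
exists (fun i => p (b i)); split=> [c|y].
  rewrite -lin_comb => /pE/asboolP[a a0].
  rewrite scaler_sumr => E i; apply: (mulfI a0); rewrite mulr0.
  apply: (bi (fun i => a * c i)); rewrite -[RHS]E.
  by apply: eq_bigr => j _; rewrite scalerA.
have [x <-] := pS y; have [a [c [a0 E]]] := bs x.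
by exists a, c; rewrite -linearZ E lin_comb.
Qed.

Definition tfree M := forall (a : R) (x : M), a != 0 -> a *: x = 0 -> x = 0.

Lemma tfree_modTor M : tfree (modTor M).
Proof.
have [p [pS pE]] := modTor_pi M => a y a0; have [x <-] := pS y.
rewrite -linearZ => /pE/asboolP[b b0 E]; apply/pE/asboolP.
by exists (b * a); rewrite ?mulf_neq0 // -scalerA.
Qed.

Lemma tfree_ffun M t : tfree M -> tfree {ffun 'I_t -> M}.
Proof.
move=> H a x a0 /ffunP E; apply/ffunP => i; rewrite ffunE; apply: (H a) => //.
by have := E i; rewrite !ffunE.
Qed.

Lemma fin_gen_surj M N (f : {linear M -> N}) : (forall y, exists x, f x = y) ->
  fin_gen M -> fin_gen N.
Proof.
move=> fS [n [g Hg]]; exists n, (fun i => f (g i)) => y; have [x <-] := fS y.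
by have [c ->] := Hg x; exists c; rewrite lin_comb.
Qed.

Lemma fin_gen_fin M (I : finType) (g : I -> M) :
  (forall x, exists c : I -> R, x = \sum_i c i *: g i) -> fin_gen M.
Proof.
move=> Hg; exists #|I|, (fun i => g (enum_val i)) => x; have [c ->] := Hg x.
exists (fun i => c (enum_val i)).
rewrite (reindex (@enum_val I predT)) //=.
by apply: onW_bij; apply: enum_val_bij.
Qed.

Lemma fin_gen_ffun M t : fin_gen M -> fin_gen {ffun 'I_t -> M}.
Proof.
move=> [n [g Hg]].
apply: (@fin_gen_fin _ ('I_t * 'I_n)%type
   (fun k => [ffun i => if i == k.1 then g k.2 else 0])) => x.
have /choice [c Hc] := fun i => Hg (x i).
exists (fun k => c k.1 k.2); apply/ffunP => i; rewrite sum_ffunE.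
rewrite -(pair_bigA _
  (fun k l => (c k l *: [ffun i => if i == k then g l else 0]) i)).
rewrite /= (bigD1 i) //= [X in _ + X]big1 => [|k /negPf ki]; last first.
  by apply: big1 => l _; rewrite !ffunE eq_sym ki scaler0.
rewrite addr0 Hc; apply: eq_bigr => l _.
by rewrite !ffunE eqxx.
Qed.

(* Coordinates in a maximal independent family, up to a common denominator. *)
Lemma fin_gen_coord M : fin_gen M -> exists n (f : 'I_n -> {linear M -> R^o}),
  forall x, (forall i, f i x = 0) <-> x \in @Tor_pred _ M.
Proof.
move=> Mf; have [n [b [bi bs]]] := fin_gen_rank Mf; exists n.
have [k [g Hg]] := Mf.
have /choice [a /choice [c Hc]] := fun j => bs (g j).
pose d := \prod_j a j.
have d0 : d != 0 by apply/prodf_neq0 => j _; exact: (Hc j).1.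
have H x : exists c : 'I_n -> R, d *: x = \sum_i c i *: b i.
  have [z ->] := Hg x.
  have /choice [w Hw] j : exists w : 'I_n -> R, d *: g j = \sum_i w i *: b i.
    exists (fun i => (\prod_(l | l != j) a l) * c j i).
    rewrite /d (bigD1 j) //= mulrC -scalerA (Hc j).2 scaler_sumr.
    by apply: eq_bigr => i _; rewrite scalerA.
  exists (fun i => \sum_j z j * w j i); rewrite scaler_sumr.
  under eq_bigr => j _ do rewrite scalerA mulrC -scalerA Hw scaler_sumr.
  rewrite exchange_big; apply: eq_bigr => i _; rewrite scaler_suml.
  by apply: eq_bigr => j _; rewrite scalerA.
have /choice [f Hf] := H.
have uniq_coord (u v : 'I_n -> R) :
    \sum_i u i *: b i = \sum_i v i *: b i -> u = v.
  move=> /eqP; rewrite -subr_eq0 -sumrB => /eqP E; apply/funext => i.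
  apply/eqP; rewrite -subr_eq0; apply/eqP; move: i; apply: bi; rewrite -[RHS]E.
  by apply: eq_bigr => i _; rewrite scalerBl.
have fP e x y : f (e *: x + y) = fun i => e * f x i + f y i.
  apply: uniq_coord; rewrite -Hf scalerDr scalerA mulrC -scalerA !Hf.
  rewrite scaler_sumr -big_split; apply: eq_bigr => i _ /=.
  by rewrite scalerDl scalerA.
have /choice [F HF] i : exists F : {linear M -> R^o}, forall x, F x = f x i.
  by apply: (@mk_linear R M R^o (fun x => f x i)) => e x y; rewrite fP.
exists F => x; split=> [Fx|/asboolP[e e0 E] i].
  apply/asboolP; exists d => //; rewrite Hf big1 // => i _.
  by rewrite -HF Fx scale0r.
apply: (mulfI e0); rewrite mulr0 -[e * _]regZ -linearZ E linear0 //.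
Qed.
End Rank.

(** * Structure of torsion-free modules *)

Section Splitting.
Variable R : idomainType.
Hypothesis hR : dedekind R.
Implicit Types M N P F : lmodType R.

(** The image of a functional is an ideal, hence projective. Splittings of modules all go back to
    this one. *)
Lemma image_split M (f : {linear M -> R^o}) :
  exists (S : submodClosed R^o) (g : {linear M -> submod S})
    (s : {linear submod S -> M}), (forall x, val (g x) = f x) /\ cancel s g.
Proof.
have [|S HS] := @ideal_submod R (fun y => exists x, f x = y).
  split; first by exists 0; rewrite linear0.
  by move=> a _ _ [x <-] [y <-]; exists (a *: x + y); rewrite linearP.
have fS x : f x \in S by apply/HS; exists x.
have [|g Hg] := @mk_linear R M (submod S) (fun x => Submod (fS x)).
  by move=> a x y; apply: val_inj; rewrite /= linearP.
have [|i Hi] := @mk_linear R (submod S) (submod S) id; first by [].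
have [|s Hs] := @hR S _ _ g i.
  move=> y; have /HS[x E] := valP y; exists x; rewrite Hg; exact: val_inj.
by exists S, g, s; split=> x; [rewrite Hg|rewrite Hs Hi].
Qed.

(** By induction: p = 1 - s g retracts onto the kernel of f_0. If q is the retraction for the
    remaining functionals composed with p, then p q serves for all of them. *)
Lemma retract_coord M n (f : 'I_n -> {linear M -> R^o}) :
  exists p : {linear M -> M}, (forall x i, f i (p x) = 0) /\
    (forall x, (forall i, f i x = 0) -> p x = x).
Proof.
elim: n f => [|n IH] f.
  have [|p Hp] := @mk_linear R M M id; first by [].
  by exists p; split=> [x []|x _].
have [S [g [s [gE gK]]]] := image_split (f ord0).
have [|p Hp] := @mk_linear R M M (fun x => x - s (g x)).
  move=> a x y; rewrite (linearP g) (linearP s) scalerBr opprD.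
  by rewrite addrACA.
have g0 x : f ord0 x = 0 -> g x = 0.
  by move=> E; apply: val_inj; rewrite gE E.
have /choice [h Hh] i := lin_comp (f (lift ord0 i)) p.
have [q [qf qE]] := IH h; have [r Hr] := lin_comp p q.
exists r; split=> [x i|x xE].
  rewrite Hr; case: (unliftP ord0 i) => [j|] ->; first by rewrite -Hh.
  by rewrite -gE Hp linearB gK subrr.
have px : p x = x by rewrite Hp g0 // linear0 subr0.
by rewrite Hr qE // => i; rewrite Hh px.
Qed.

(** F embeds in some R^n, so the kernel of g is the common kernel of finitely many functionals on
    M. *)
Lemma retract_ker M F (g : {linear M -> F}) : fin_gen F -> tfree F ->
  exists p : {linear M -> M}, (forall x, g (p x) = 0) /\
    (forall x, g x = 0 -> p x = x).
Proof.
move=> /fin_gen_coord [n [f fE]] Ft.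
have /choice [h Hh] i := lin_comp (f i) g.
have [p [p0 pE]] := retract_coord h; exists p; split=> [x|x gx].
  have /asboolP [a a0] : g (p x) \in @Tor_pred _ F.
    by apply/fE => i; rewrite -Hh.
  exact: Ft.
by apply: pE => i; rewrite Hh gx linear0.
Qed.

Lemma retract_Tor M : fin_gen M -> exists p : {linear M -> M},
  (forall x, p x \in @Tor_pred _ M) /\
  (forall x, x \in @Tor_pred _ M -> p x = x).
Proof.
move=> Mf; have [q [qS qE]] := modTor_pi M.
have [||p [p0 pE]] := @retract_ker M (modTor M) q.
- exact: fin_gen_surj Mf.
- exact: tfree_modTor.
by exists p; split=> x; [apply/qE|move/qE; exact: pE].
Qed.

Lemma fin_gen_ker M F (g : {linear M -> F}) :
  fin_gen M -> fin_gen F -> tfree F ->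
  fin_gen (submod (kerp g)).
Proof.
move=> Mf Ff Ft; have [p [p0 pE]] := retract_ker g Ff Ft.
have pk x : p x \in kerp g by apply/eqP.
have [|h Hh] := @mk_linear R M (submod (kerp g)) (fun x => Submod (pk x)).
  by move=> a x y; apply: val_inj; rewrite /= linearP.
apply: (fin_gen_surj (f := h)) Mf => y; exists (val y); rewrite Hh.
by apply: val_inj; apply: pE; apply/eqP; exact: (valP y).
Qed.

(** Each functional with nonzero image splits off that image, an ideal S; [iso_ideal_sum] then
    trades I + S for R + IS, so that a single ideal remains. *)
Lemma structure_coord n P (f : 'I_n -> {linear P -> R^o}) :
  (forall x, (forall i, f i x = 0) -> x = 0) ->
  (forall x : P, x = 0) \/ exists k (I : submodClosed R^o), nonzero I /\
     iso_mod P ({ffun 'I_k -> R^o} * submod I)%type.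
Proof.
elim: n P f => [|n IH] P f f0; first by left=> x; apply: f0 => -[].
have [S [g [s [gE gK]]]] := image_split (f ord0).
have g0 x : g x = 0 -> f ord0 x = 0 by rewrite -gE => ->.
have [Snz|Sz] := pselect (nonzero S); last first.
  apply: (IH _ (fun i => f (lift ord0 i))) => x xE; apply: f0 => i.
  case: (unliftP ord0 i) => [j|] -> //; rewrite -gE.
  apply: contrapT => /eqP gx; apply: Sz; exists (val (g x)) => //.
  exact: (valP (g x)).
right; have [i Hi] := submod_val_lin (kerp g).
have pk x : x - s (g x) \in kerp g by apply/eqP; rewrite linearB gK subrr.
have isoP : iso_mod P (submod (kerp g) * submod S)%type.
  apply: (@mk_iso _ P (submod (kerp g) * submod S)%type
     (fun x => (Submod (pk x), g x))).
  - move=> a x y; congr (_, _); last by rewrite /= linearP.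
    apply: val_inj; rewrite /= (linearP g) (linearP s) scalerBr opprD.
    by rewrite addrACA.
  - move=> x H; have E : g x = 0 := congr1 snd H.
    have : x - s (g x) = 0 := congr1 (fun w => val w.1) H.
    by rewrite E linear0 subr0.
  move=> [x y]; have gx : g (val x) = 0 by apply/eqP; exact: (valP x).
  exists (val x + s y); congr (_, _); last by rewrite linearD gx gK add0r.
  by apply: val_inj; rewrite /= linearD gx gK add0r addrK.
have /choice [h Hh] j := lin_comp (f (lift ord0 j)) i.
have [|P0|[k [I [Inz isoI]]]] := IH _ h.
- move=> x xE; apply: val_inj; apply: f0 => j.
  case: (unliftP ord0 j) => [l|] ->; first by rewrite -[RHS](xE l) Hh Hi.
  by apply: g0; apply/eqP; exact: (valP x).
- exists 0%N, S; split=> //; apply: iso_trans isoP _.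
  apply: iso_prod; last exact: iso_refl.
  apply: (@mk_iso _ (submod (kerp g)) {ffun 'I_0 -> R^o} (fun=> 0)) => //.
    by move=> a x y; rewrite scaler0 addr0.
  by move=> y; exists 0; apply/ffunP => -[].
exists (k + 1)%N, (iprod I S); split; first exact: iprod_nonzero.
apply: iso_trans isoP _.
apply: iso_trans (iso_prod isoI (iso_refl _)) _.
apply: iso_trans (iso_sym (iso_prodA _ _ _)) _.
apply: iso_trans (iso_prod (iso_refl _) (iso_ideal_sum hR Inz Snz)) _.
apply: iso_trans (iso_prodA _ _ _) _.
apply: iso_prod; last exact: iso_refl.
apply: iso_trans (iso_ffunD R^o k 1).
apply: iso_prod; first exact: iso_refl.
exact: iso_sym (iso_ffun1 _).
Qed.
End Splitting.

(** * Rank and extension of scalars *)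

Section Dimension.
Variable K : fieldType.

Lemma basis_leq (V : lmodType K) m n (b : 'I_m -> V) (d : 'I_n -> V) :
  injective (fun c : 'rV[K]_m => \sum_(i < m) c 0 i *: b i) ->
  (forall x, exists c : 'rV[K]_n, \sum_(i < n) c 0 i *: d i = x) -> (m <= n)%N.
Proof.
move=> bi ds; have /choice [a Ha] := fun i => ds (b i).
pose A := \matrix_(i, j) a i 0 j.
have AE (v : 'rV[K]_m) :
    \sum_(i < m) v 0 i *: b i = \sum_(j < n) (v *m A) 0 j *: d j.
  under eq_bigr => i _ do rewrite -Ha scaler_sumr.
  rewrite exchange_big; apply: eq_bigr => j _; rewrite mxE scaler_suml.
  by apply: eq_bigr => i _; rewrite scalerA mxE.
have /eqP <- : row_free A.
  apply: inj_row_free => v vA; apply: bi; rewrite /= AE vA !big1 // => i _;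
  by rewrite mxE scale0r.
exact: rank_leq_col.
Qed.

Lemma dimension_basis (V : lmodType K) n (b : 'I_n -> V) :
  bijective (fun c : 'rV[K]_n => \sum_(i < n) c 0 i *: b i) -> dimension V = n.
Proof.
move=> bb; rewrite /dimension.
case: xgetP => [m _ [d db]|/(_ n)[]]; last by exists b.
have surj k (c : 'I_k -> V) :
    bijective (fun a : 'rV[K]_k => \sum_(i < k) a 0 i *: c i) ->
    forall x, exists a : 'rV[K]_k, \sum_(i < k) a 0 i *: c i = x.
  by move=> [g _ gK] x; exists (g x); exact: gK.
apply/eqP; rewrite eqn_leq (basis_leq (bij_inj db) (surj _ _ bb)).
exact: basis_leq (bij_inj bb) (surj _ _ db).
Qed.
End Dimension.

Section RankE.
Variable R : idomainType.
Local Notation K := {fraction R}.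
Local Notation iota := (@tofrac R).

Lemma tofrac_neq0 (a : R) : a != 0 -> iota a != 0.
Proof. by rewrite tofrac_eq0. Qed.

(** Stated for any quotient map p whose kernel is generated by the tensor relations, so that the
    argument never enters the construction of [extscal]. *)
Lemma tensor_dimension (M : lmodType R) (V : lmodType K)
  (p : {linear {freeg M / K} -> V}) n : (forall y, exists x, p x = y) ->
  (forall x, p x = 0 <-> x \in gen_submod (@tensor_rel R K iota M)) ->
  has_rank M n -> dimension V = n.
Proof.
move=> pS pE [b [bi bs]].
pose e m : V := p << m >>.
have eD x y : e (x + y) = e x + e y.
  apply/eqP; rewrite -subr_eq0 opprD addrA; apply/eqP.
  rewrite /e -!linearB; apply/pE; apply: sub_gen_submod.
  exact: tensor_relD.
have gU (k : K) (x : M) : << k *g x >> = k *: << x >> :> {freeg M / K}.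
  by apply/eqP/freeg_eqP => y; rewrite coeffZ !coeffU mul1r.
have eZ a x : e (a *: x) = iota a *: e x.
  apply/eqP; rewrite -subr_eq0; apply/eqP.
  rewrite /e -linearZ -linearB; apply/pE; apply: sub_gen_submod.
  rewrite -gU; exact: tensor_relZ.
have eS (c : 'I_n -> R) : e (\sum_i c i *: b i) = \sum_i iota (c i) *: e (b i).
  have e0 : e 0 = 0 by rewrite -(scale0r 0) eZ rmorph0 scale0r.
  by rewrite (big_morph e eD e0); apply: eq_bigr => i _; rewrite eZ.
have /choice [a /choice [c Hac]] := bs.
(* The coordinates of x over K. The chosen a and c do not affect them, by independence of b: this is
   [lE], from which [lD] and [lZ] follow. *)
pose l x : 'rV[K]_n := \row_i (iota (c x i) / iota (a x)).
have lE x d (f : 'I_n -> R) : d != 0 -> d *: x = \sum_i f i *: b i ->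
    l x = \row_i (iota (f i) / iota d).
  move=> d0 E; have [a0 E'] := Hac x; apply/rowP => i; rewrite !mxE.
  apply/eqP; rewrite eqr_div ?tofrac_neq0 // -!rmorphM tofrac_eq.
  rewrite -subr_eq0; apply/eqP; move: i.
  apply: (bi (fun i => c x i * d - f i * a x)).
  under eq_bigr => i _
    do rewrite scalerBl ![_ * d]mulrC ![_ * a x]mulrC -!scalerA.
  rewrite sumrB -!scaler_sumr -E -E' !scalerA.
  by rewrite [a x * d]mulrC subrr.
have [L HL] := @freeg_lift K M 'rV[K]_n l.
have lD x y : l (x + y) = l x + l y.
  have [a0 E] := Hac x; have [d0 F] := Hac y.
  rewrite (@lE _ (a x * a y) (fun i => a y * c x i + a x * c y i))
    ?mulf_neq0 //.
    apply/rowP => i; rewrite !mxE addf_div ?tofrac_neq0 //.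
    by rewrite !rmorphM rmorphD !rmorphM ![_ * iota (c _ _)]mulrC.
  rewrite scalerDr -[in X in X + _]mulrC -!scalerA E F !scaler_sumr -big_split.
  by apply: eq_bigr => i _; rewrite /= !scalerA scalerDl.
have lZ d x : l (d *: x) = iota d *: l x.
  have [a0 E] := Hac x.
  rewrite (@lE _ (a x) (fun i => d * c x i)) //.
    by apply/rowP => i; rewrite !mxE rmorphM mulrA.
  rewrite scalerA mulrC -scalerA E scaler_sumr.
  by apply: eq_bigr => i _; rewrite scalerA.
(* L respects the tensor relations, so it factors through p; the factor [Bi] inverts the map given
   by the proposed basis. *)
have pL v : p v = 0 -> L v = 0.
  move/pE => H; apply/eqP; rewrite -mem_kerp.
  apply: (@gen_submod_min _ _ (@tensor_rel R K iota M) (kerp L)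
    (kerp_closed L) _ v H).
  move=> _ [x y|d x]; apply/eqP.
    by rewrite !linearB !HL !scale1r lD -addrA -opprD subrr.
  by rewrite linearB !HL scale1r lZ subrr.
apply: (@dimension_basis K V n (fun i => e (b i))).
pose B (u : 'rV[K]_n) : V := \sum_i u 0 i *: e (b i).
have Be x : B (l x) = e x.
  have [a0 E] := Hac x; apply: (scalerI (tofrac_neq0 a0)).
  have -> : iota (a x) *: e x = \sum_i iota (c x i) *: e (b i).
    by rewrite -eS -E eZ.
  rewrite [LHS]scaler_sumr; apply: eq_bigr => i _; rewrite scalerA mxE.
  by rewrite [iota (a x) * _]mulrC divfK ?tofrac_neq0.
have BD k u v : B (k *: u + v) = k *: B u + B v.
  rewrite /B scaler_sumr -big_split; apply: eq_bigr => i _.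
  by rewrite !mxE scalerDl scalerA.
have BL v : B (L v) = p v.
  rewrite -[v]freeg_sumE !linear_sum.
  have B0 : B 0 = 0 by rewrite /B big1 // => i _; rewrite mxE scale0r.
  have BA u w : B (u + w) = B u + B w by rewrite -[u in LHS]scale1r BD scale1r.
  rewrite (big_morph B BA B0); apply: eq_bigr => x _.
  by rewrite HL -[_ *: _]addr0 BD B0 addr0 Be gU linearZ.
have lb i : l (b i) = delta_mx 0 i.
  have [a0 E] := Hac (b i).
  rewrite (@lE _ 1 (fun j => (j == i)%:R)) ?oner_neq0 //.
    by apply/rowP => j; rewrite !mxE rmorph1 divr1 rmorph_nat.
  rewrite scale1r (bigD1 i) //= eqxx scale1r big1 ?addr0 // => j /negPf->.
  exact: scale0r.
have [Bi HBi] : exists g : V -> 'rV[K]_n, forall v, g (p v) = L v.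
  have /choice [s Hs] := pS; exists (fun y => L (s y)) => v.
  apply/eqP; rewrite -subr_eq0 -linearB; apply/eqP/pL.
  by rewrite linearB Hs subrr.
exists Bi => [u|y].
  have -> : \sum_(i < n) u 0 i *: e (b i) = p (\sum_i u 0 i *: << b i >>).
    by rewrite linear_sum; apply: eq_bigr => i _; rewrite linearZ.
  rewrite HBi linear_sum [RHS]row_sum_delta; apply: eq_bigr => i _.
  by rewrite linearZ HL scale1r lb.
by have [v <-] := pS y; rewrite HBi; exact: BL.
Qed.

Lemma rankE (M : lmodType R) n : has_rank M n -> rank M = n.
Proof.
have [p [pS pE]] := quotmod_pi (gen_submod (@tensor_rel R K iota M)).
exact: (@tensor_dimension M (extscal iota M) p).
Qed.

Lemma rankP (M : lmodType R) : fin_gen M -> has_rank M (rank M).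
Proof. by move=> /fin_gen_rank [n Mn]; rewrite (rankE Mn). Qed.

Lemma has_rank_inj (M : lmodType R) m n : has_rank M m -> has_rank M n -> m = n.
Proof. by move=> /rankE <- /rankE <-. Qed.
End RankE.

(** * The Steinitz class *)

Section Determinant.
Variable R : idomainType.
Local Notation K := {fraction R}.
Local Notation iota := (@tofrac R).
Variable n : nat.
Implicit Types I J : submodClosed R^o.
Local Notation free I := ({ffun 'I_n -> R^o} * submod I)%type.

Definition coords I (v : free I) : 'rV[R]_(n + 1) :=
  row_mx (\row_i (v.1 i : R)) (val v.2 : R)%:M.

Lemma coords_lin I a (v w : free I) :
  coords (a *: v + w) = a *: coords v + coords w.
Proof.
rewrite /coords scale_row_mx add_row_mx; congr row_mx.
  by apply/rowP => i; rewrite !mxE !ffunE.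
by apply/rowP => i; rewrite !mxE -mulr_natr mulrDl !mulr_natr mulrnAr.
Qed.

(** The unit vectors of R^n followed by x. For x nonzero this is a K-basis in which multiples x v
    have coefficients in R: x (f, y) = (x f, 0) + y (0, x). *)
Definition frame I (x : submod I) (k : 'I_(n + 1)) : free I :=
  match split k with
  | inl i => ([ffun j => ((i == j)%:R : R^o)], 0)
  | inr _ => (0, x)
  end.

Definition frame_coef I (x : submod I) (v : free I) : 'rV[R]_(n + 1) :=
  row_mx (\row_i ((val x : R) * v.1 i)) (val v.2 : R)%:M.

Lemma frameE I (x : submod I) (v : free I) :
  (val x : R) *: v = \sum_k frame_coef x v 0 k *: frame x k.
Proof.
rewrite big_split_ord /= big_ord1 /frame_coef.
under eq_bigr => i _ do rewrite row_mxEl mxE /frame (unsplitK (inl i)).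
rewrite row_mxEr mxE eqxx mulr1n /frame (unsplitK (inr 0)).
case: v => [f y] /=.
have -> : \sum_(i < n) ((val x : R) * f i) *:
    ([ffun j => ((i == j)%:R : R^o)], 0 : submod I) = ((val x : R) *: f, 0).
  rewrite [LHS]surjective_pairing; congr (_, _).
    rewrite raddf_sum /=; apply/ffunP => j; rewrite sum_ffunE !ffunE.
    rewrite (bigD1 j) //= !ffunE eqxx regZ mulr1 big1 ?addr0 // => i /negPf ij.
    by rewrite !ffunE ij scaler0.
  by rewrite raddf_sum /= big1 // => i _; rewrite scaler0.
congr (_, _); rewrite /= ?scaler0 ?addr0 ?add0r //.
by apply: val_inj; rewrite /= !regZ mulrC.
Qed.

Definition emb I (v : free I) : 'rV[K]_(n + 1) := map_mx iota (coords v).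

Lemma emb_lin I a (v w : free I) : emb (a *: v + w) = iota a *: emb v + emb w.
Proof. by rewrite /emb coords_lin map_mxD map_mxZ. Qed.

Definition frame_mx I J (f : {linear free I -> free J}) (x : submod I) :
    'M[R]_(n + 1) :=
  \matrix_(k, l) coords (f (frame x k)) 0 l.

Lemma emb_frame I J (f : {linear free I -> free J}) (x : submod I)
    (v : free I) :
  iota (val x : R) *: emb (f v) =
  map_mx iota (frame_coef x v) *m map_mx iota (frame_mx f x).
Proof.
have e0 : emb (0 : free J) = 0.
  have := emb_lin (-1) 0 (0 : free J).
  by rewrite scaler0 addr0 rmorphN1 scaleN1r addNr.
have eD (u w : free J) : emb (u + w) = emb u + emb w.
  by have := emb_lin 1 u w; rewrite rmorph1 !scale1r.
have eZ a (u : free J) : emb (a *: u) = iota a *: emb u.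
  by have := emb_lin a u 0; rewrite e0 !addr0.
rewrite -eZ -linearZ frameE lin_comb (big_morph _ eD e0).
apply/rowP => l; rewrite !mxE summxE; apply: eq_bigr => k _.
by rewrite eZ !mxE.
Qed.

Lemma det_frame_id I (x : submod I) (f : {linear free I -> free I}) :
  (forall v, f v = v) -> \det (frame_mx f x) = val x.
Proof.
move=> fE; have -> : frame_mx f x = block_mx 1%:M 0 0 (val x : R)%:M.
  apply/matrixP => k l; rewrite mxE fE /coords.
  case: (split_ordP k) => i ->;
    rewrite /frame ?(unsplitK (inl i)) ?(unsplitK (inr i)).
    case: (split_ordP l) => j ->;
      rewrite ?row_mxEl ?row_mxEr ?block_mxEul ?block_mxEur !mxE.
      by rewrite !ffunE.
    by rewrite mul0rn.
  case: (split_ordP l) => j ->;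
    rewrite ?row_mxEl ?row_mxEr ?block_mxEdl ?block_mxEdr !mxE.
    by rewrite !ffunE.
  by rewrite !ord1.
by rewrite det_ublock det1 mul1r det_scalar1.
Qed.

(** The last column consists of the J-components of the images; expand along it. *)
Lemma det_frame_mem I J (f : {linear free I -> free J}) (x : submod I) :
  \det (frame_mx f x) \in J.
Proof.
have Ji := submod_ideal J.
rewrite (expand_det_col _ (rshift n 0)).
apply: (ideal_sum _ Ji) => i; rewrite mulrC; apply: (idealM _ Ji).
by rewrite mxE row_mxEr mxE eqxx mulr1n; exact: valP.
Qed.

(** F is the K-linear extension of f, the same for all x, whereas the frame matrix of f at x is a
    matrix of determinant x times F. Hence x det F is the determinant of the frame matrix, an
    element of J. *)
Lemma linear_mx I J (f : {linear free I -> free J}) : nonzero I ->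
  exists F : 'M[K]_(n + 1), (forall v, emb (f v) = emb v *m F) /\
    forall x : submod I,
      exists2 y : R, y \in J & iota (val x : R) * \det F = iota y.
Proof.
move=> [x0 xI x00]; pose X0 := Submod xI.
have [|id' idE] := @mk_linear R (free I) (free I) id; first by [].
pose E (x : submod I) := map_mx iota (frame_mx id' x).
have detE x : \det (E x) = iota (val x : R) by rewrite det_map_mx det_frame_id.
have E0 : E X0 \in unitmx by rewrite unitmxE detE unitfE tofrac_neq0.
pose F := invmx (E X0) *m map_mx iota (frame_mx f X0).
have FE v : emb (f v) = emb v *m F.
  apply: (scalerI (tofrac_neq0 x00)).
  have -> : x0 = val X0 by [].
  rewrite emb_frame -[v in RHS]idE scalemxAl emb_frame /F mulmxA.
  by rewrite (mulmxK E0).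
exists F; split=> // x.
exists (\det (frame_mx f x)); first exact: det_frame_mem.
rewrite -detE -det_mulmx -det_map_mx; congr (\det _).
apply/row_matrixP => k; rewrite row_mul.
have rE (g : {linear free I -> free I}) :
    row k (map_mx iota (frame_mx g x)) = emb (g (frame x k)).
  by apply/rowP => l; rewrite !mxE.
rewrite rE idE -FE; by apply/rowP => l; rewrite !mxE.
Qed.

(* A linear isomorphism R^n + I -> R^n + J extends to K^(n+1); its determinant
   maps I onto J. *)
Lemma steinitz_unique I J : nonzero I -> nonzero J ->
  iso_mod (free I) (free J) ->
  exists p q : R, [/\ p != 0, q != 0,
    forall x : R, x \in I -> exists2 y : R, y \in J & p * x = q * y &
    forall y : R, y \in J -> exists2 x : R, x \in I & q * y = p * x].
Proof.
move=> I0 J0 /iso_lin [f [g [fK gK]]].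
have [F [FE FI]] := linear_mx f I0; have [G [GE GJ]] := linear_mx g J0.
have [x0 xI x00] := I0; pose X0 := Submod xI.
have FG : \det F * \det G = 1.
  rewrite -det_mulmx; suff -> : F *m G = 1%:M by rewrite det1.
  have [|id' idE] := @mk_linear R (free I) (free I) id; first by [].
  pose E := map_mx iota (frame_mx id' X0).
  have E0 : E \in unitmx.
    by rewrite unitmxE det_map_mx det_frame_id // unitfE tofrac_neq0.
  apply: (can_inj (mulKmx E0)); rewrite mulmx1.
  apply/row_matrixP => k; rewrite row_mul mulmxA.
  have -> : row k E = emb (frame X0 k).
    by apply/rowP => l; rewrite !mxE idE.
  by rewrite -FE -GE fK.
have [y0 y0J Ey0] := FI X0.
have y00 : y0 != 0.
  rewrite -(tofrac_eq0 y0) -Ey0 mulf_neq0 ?tofrac_neq0 //.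
  by apply/negP => /eqP F0; move/eqP: FG; rewrite F0 mul0r eq_sym oner_eq0.
(* These multipliers express det F = y0 / x0 as a fraction. *)
exists y0, x0; split=> // [x xI'|y yJ].
  have [y yJ Ey] := FI (Submod xI'); exists y => //.
  apply/eqP; rewrite -(tofrac_eq (y0 * x)) !rmorphM /= -Ey -Ey0 /=.
  by rewrite mulrAC mulrA.
have [x xI' Ex] := GJ (Submod yJ); exists x => //.
apply/eqP; rewrite -(tofrac_eq (x0 * y)) !rmorphM /= -Ex -Ey0 /=.
by rewrite mulrACA FG mulr1.
Qed.

End Determinant.

(** * Classes of powers, and surjections between modules of unequal rank *)

Section SteinitzClass.
Variable R : idomainType.
Hypothesis hR : dedekind R.
Implicit Types M N P : lmodType R.
Implicit Types I J : submodClosed R^o.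

Lemma Pic_class_iprod I J (I0 : nonzero I) (J0 : nonzero J)
    (IJ0 : nonzero (iprod I J)) :
  Pic_class (fi_ideal IJ0) =
    (Pic_class (fi_ideal I0) * Pic_class (fi_ideal J0))%g.
Proof.
rewrite [RHS]Pic_mulE; congr Pic_class; apply: fracIdealP => x; apply/idP/idP.
  move=> /asboolP [z zIJ ->].
  apply: (@iprod_min _ I J
    (fun z => tofrac z \in fi_mul (fi_ideal I0) (fi_ideal J0)) _ _ z zIJ).
    have [M0 Ml] := fi_closed (fi_mul (fi_ideal I0) (fi_ideal J0)).
    split=> [|a u v uM vM]; first by rewrite rmorph0.
    by rewrite rmorphD rmorphM -frac_scaleE; apply: Ml.
  move=> u v uI vJ; rewrite rmorphM; apply: mem_fi_mul; apply/asboolP.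
    by exists u.
  by exists v.
apply: fi_mul_min; first exact: fi_closed.
move=> _ _ /asboolP[u uI ->] /asboolP[v vJ ->]; apply/asboolP.
by exists (u * v); [exact: mem_iprod|rewrite rmorphM].
Qed.

Lemma Pic_class_eq I J (I0 : nonzero I) (J0 : nonzero J) :
  Pic_class (fi_ideal I0) = Pic_class (fi_ideal J0) <->
  exists p q : R, [/\ p != 0, q != 0,
    forall x : R, x \in I -> exists2 y : R, y \in J & p * x = q * y &
    forall y : R, y \in J -> exists2 x : R, x \in I & q * y = p * x].
Proof.
rewrite Pic_classP; split=> [/fi_equivP|] [p [q [p0 q0 H1 H2]]].
  exists p, q; split=> // x xI.
    have [|_ /asboolP[y yJ ->] E] := H1 (tofrac x).
      by apply/asboolP; exists x.
    by exists y => //; apply/eqP; rewrite -tofrac_eq !rmorphM; apply/eqP.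
  have [|_ /asboolP[y yJ ->] E] := H2 (tofrac x).
      by apply/asboolP; exists x.
  by exists y => //; apply/eqP; rewrite -tofrac_eq !rmorphM; apply/eqP.
apply/fi_equivP; exists p, q; split=> // _ /asboolP[x xI ->].
  have [y yJ E] := H1 x xI; exists (tofrac y); first by apply/asboolP; exists y.
  by rewrite !frac_scaleE -!rmorphM E.
have [y yJ E] := H2 x xI; exists (tofrac y); first by apply/asboolP; exists y.
by rewrite !frac_scaleE -!rmorphM E.
Qed.

Lemma Pic_class_iso I J (I0 : nonzero I) (J0 : nonzero J) :
  Pic_class (fi_ideal I0) = Pic_class (fi_ideal J0) ->
  iso_mod (submod I) (submod J).
Proof.
move=> /Pic_class_eq [p [q [p0 q0 H1 H2]]].
have /choice [f Hf] : forall x : submod I, exists y : submod J,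
    p * (val x : R) = q * (val y : R).
  move=> x; have [y yJ E] := H1 _ (valP x); exists (Submod yJ); exact: E.
apply: (@mk_iso _ (submod I) (submod J) f) => [a x y|x fx|y].
- apply: val_inj; apply: (mulfI q0); rewrite -Hf /= !regZ !mulrDr mulrCA !Hf.
  by congr (_ + _); rewrite mulrCA.
- by apply: val_inj; apply: (mulfI p0); rewrite Hf fx /= !mulr0.
have [x xI E] := H2 _ (valP y); exists (Submod xI); apply: val_inj.
by apply: (mulfI q0); rewrite -Hf /= E.
Qed.

Lemma structure P n : fin_gen P -> tfree P -> has_rank P n.+1 ->
  exists I : submodClosed R^o, nonzero I /\
    iso_mod P ({ffun 'I_n -> R^o} * submod I)%type.
Proof.
move=> Pf Pt Pn; have [k [f fE]] := fin_gen_coord Pf.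
have [|P0|[m [I [I0 isoP]]]] := structure_coord hR (f := f).
- by move=> x /fE/asboolP[a a0]; exact: Pt.
- have : has_rank P 0.
    by apply: has_rank_torsion => x; rewrite (P0 x); exact: rpred0.
  by move=> /(has_rank_inj Pn).
have := has_rank_iso isoP (has_rank_prod (has_rank_ffun m (has_rank_regular R))
   (has_rank_ideal I0)).
move=> /(has_rank_inj Pn); rewrite muln1 addn1 => -[nm]; subst m.
by exists I.
Qed.

Lemma rank0_eq0 P : tfree P -> has_rank P 0 -> forall x : P, x = 0.
Proof.
move=> Pt [b [_ bs]] x; have [a [c [a0]]] := bs x.
by rewrite big_ord0; exact: Pt.
Qed.

Lemma steinitzP M n : fin_gen M -> rank M = n.+1 ->
  exists I (I0 : nonzero I), steinitz M = Pic_class (fi_ideal I0) /\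
    iso_mod (modTor M) ({ffun 'I_n -> R^o} * submod I)%type.
Proof.
move=> Mf Mn; rewrite /steinitz Mn /=.
case: xgetP => [c _ [I [I0 [-> H]]]|]; first by exists I, I0.
(* The default value in [steinitz] is excluded: [structure] exhibits a class of the required
   kind. *)
have [p [pS _]] := modTor_pi M.
have [|||I [I0 H]] := @structure (modTor M) n.
- exact: fin_gen_surj Mf.
- exact: tfree_modTor.
- by apply: has_rank_modTor; rewrite -Mn; exact: rankP.
by move/(_ (Pic_class (fi_ideal I0)))=> []; exists I, I0.
Qed.

(** Each further copy of P contributes an ideal I, merged with the previous J into R + IJ: classes
    multiply and one free summand is gained. *)
Lemma steinitz_pow P n I (I0 : nonzero I) t :
  iso_mod P ({ffun 'I_n -> R^o} * submod I)%type ->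
  exists J (J0 : nonzero J),
    Pic_class (fi_ideal J0) = (Pic_class (fi_ideal I0) ^+ t.+1)%g /\
    iso_mod {ffun 'I_t.+1 -> P}
      ({ffun 'I_(t.+1 * n.+1).-1 -> R^o} * submod J)%type.
Proof.
move=> PI; elim: t => [|t [J [J0 [JE PJ]]]].
  exists I, I0; split=> //; rewrite mul1n; exact: iso_trans (iso_ffun1 P) PI.
exists (iprod I J), (iprod_nonzero I0 J0); split.
  by rewrite (Pic_class_iprod I0 J0) JE -expgS.
apply: iso_trans (iso_sym (iso_ffunD P 1 t.+1)) _.
apply: iso_trans (iso_prod (iso_trans (iso_ffun1 P) PI) PJ) _.
apply: iso_trans (iso_prodACA _ _ _ _) _.
apply: iso_trans (iso_prod (iso_refl _) (iso_ideal_sum hR I0 J0)) _.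
apply: iso_trans (iso_prodA _ _ _) _.
apply: iso_prod; last exact: iso_refl.
(* The free rank: n from the new copy, the rank from the earlier copies, and 1 from merging the
   ideals. *)
have -> : (t.+2 * n.+1).-1 = ((n + (t.+1 * n.+1).-1) + 1)%N.
  by rewrite [in LHS]mulSn /= mulSn /= addn1 addSn -!addnS.
apply: iso_trans (iso_ffunD R^o _ 1).
apply: iso_prod; last exact: iso_sym (iso_ffun1 _).
exact: iso_ffunD.
Qed.

(** Take L = C I with C = (c) : J. Then J C = (c), so J L = c I, which is isomorphic to I. *)
Lemma iso_ideal_colon I J : nonzero I -> nonzero J ->
  exists L, nonzero L /\ iso_mod (submod I) (submod (iprod J L)).
Proof.
move=> I0 [c cJ c0]; have Ii := submod_ideal I; have Ji := submod_ideal J.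
have [n [x [a [xJ aJ E]]]] := ideal_inv hR Ji cJ c0.
have [|C HC] := @ideal_submod R
    (fun y => forall z, z \in J -> exists b, y * z = c * b).
  split=> [z zJ|r y y' H H' z zJ]; first by exists 0; rewrite mul0r mulr0.
  have [b Hb] := H z zJ; have [b' Hb'] := H' z zJ.
  by exists (r * b + b'); rewrite mulrDl -mulrA Hb Hb'; ring.
have C0 : nonzero C.
  by exists c => //; apply/HC => z zJ; exists z.
exists (iprod C I); split; first exact: iprod_nonzero.
have fP (z : submod I) : c * (val z : R) \in iprod J (iprod C I).
  rewrite -E mulr_suml; apply: (ideal_sum _ (submod_ideal _)) => i.
  rewrite [a i * _]mulrC -mulrA; apply: mem_iprod => //.
  apply: mem_iprod; last exact: valP.
  by apply/HC => y yJ; exact: aJ.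
apply: (@mk_iso _ (submod I) (submod (iprod J (iprod C I)))
  (fun z => Submod (fP z))).
- by move=> r y z; apply: val_inj; rewrite /= !regZ; ring.
- move=> z H; have : c * (val z : R) = 0 := congr1 val H.
  by move/eqP; rewrite mulf_eq0 (negPf c0) => /eqP z0; apply: val_inj.
move=> y; suff [z zI yE] : exists2 z, z \in I & (val y : R) = c * z.
  by exists (Submod zI); apply: val_inj; rewrite /= yE.
have zi : ideal (fun y => exists2 z, z \in I & y = c * z).
  split; first by exists 0; rewrite ?mulr0 //; exact: Ii.1.
  move=> r _ _ [z zI ->] [z' z'I ->]; exists (r * z + z'); first exact: Ii.2.
  by ring.
apply: (@iprod_min _ J (iprod C I)
  (fun y => exists2 z, z \in I & y = c * z) zi _ _ (valP y)).
move=> u v uJ vCI.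
apply: (@iprod_min _ C I (fun v => exists2 z, z \in I & u * v = c * z) _ _ _ vCI).
  split=> [|r y1 y2 [z1 z1I E1] [z2 z2I E2]].
    by exists 0; rewrite ?mulr0 //; exact: Ii.1.
  exists (r * z1 + z2); first exact: Ii.2.
  by rewrite mulrDr mulrCA E1 E2; ring.
move=> s w /HC/(_ u uJ)[b Eb] wI; exists (b * w); first exact: (idealM _ Ii).
by rewrite mulrA [u * s]mulrC Eb mulrA.
Qed.

(** For q > 0, the strict inequality leaves a free summand to spare: writing I as JL, R + I = R + JL
    = J + L, so the ideal J of Q splits off from P whatever the classes are. *)
Lemma surj_rank_lt P Q p q : fin_gen P -> tfree P -> has_rank P p ->
  fin_gen Q -> tfree Q -> has_rank Q q -> (q < p)%N ->
  exists f : {linear P -> Q}, forall y, exists x, f x = y.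
Proof.
move=> Pf Pt; case: p => // p Pp Qf Qt.
case: q => [|q] Qq.
  move=> _; have Q0 := rank0_eq0 Qt Qq.
  have [|f Hf] := @mk_linear R P Q (fun=> 0).
    by move=> a x y; rewrite scaler0 addr0.
  by exists f => y; exists 0; rewrite linear0 (Q0 y).
rewrite ltnS => qp.
have [I [I0 PI]] := structure Pf Pt Pp; have [J [J0 QJ]] := structure Qf Qt Qq.
have [L [L0 IL]] := iso_ideal_colon I0 J0.
have pE : p = (p - q.+1 + q + 1)%N by rewrite -addnA addn1 subnK.
have isoP : iso_mod P (({ffun 'I_(p - q.+1) -> R^o} * submod L) *
    ({ffun 'I_q -> R^o} * submod J))%type.
  apply: iso_trans PI _; rewrite {1}pE.
  apply: iso_trans (iso_prod (iso_sym (iso_ffunD _ _ _)) IL) _.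
  apply: iso_trans (iso_sym (iso_prodA _ _ _)) _.
  apply: iso_trans (iso_prod (iso_sym (iso_ffunD _ _ _))
    (iso_trans (iso_prod (iso_ffun1 _) (iso_refl _))
      (iso_sym (iso_ideal_sum hR J0 L0)))) _.
  apply: iso_trans (iso_prod (iso_refl _) (iso_prodC _ _)) _.
  exact: iso_prodACA.
have [f [f' [fK f'K]]] := iso_lin isoP; have [g [g' [gK g'K]]] := iso_lin QJ.
have [|h Hh] := @mk_linear R P Q (fun x => g' (f x).2).
  by move=> a x y; rewrite (linearP f) (linearP g').
by exists h => y; exists (f' (0, g y)); rewrite Hh f'K gK.
Qed.

End SteinitzClass.

Lemma lin_factor (R : nzRingType) (U V W : lmodType R) (p : {linear U -> V})
  (g : {linear U -> W}) : (forall y, exists x, p x = y) ->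
  (forall x, p x = 0 -> g x = 0) ->
  exists h : {linear V -> W}, forall x, h (p x) = g x.
Proof.
move=> /choice[s Hs] pg.
have gE x y : p x = p y -> g x = g y.
  move=> E; apply/eqP; rewrite -subr_eq0 -linearB; apply/eqP/pg.
  by rewrite linearB E subrr.
have [|h Hh] := @mk_linear R V W (fun y => g (s y)).
  move=> a x y; rewrite -(linearP g); apply: gE.
  by rewrite (linearP p) !Hs.
by exists h => x; rewrite Hh; apply: gE; rewrite Hs.
Qed.

Lemma lin_ffun (R : nzRingType) (U V : lmodType R) t (f : {linear U -> V}) :
  exists F : {linear {ffun 'I_t -> U} -> {ffun 'I_t -> V}},
    forall x, F x = [ffun i => f (x i)].
Proof.
apply: mk_linear => a x y; apply/ffunP => i.
by rewrite !ffunE (linearP f).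
Qed.

(** * Surjections onto powers *)

Section Sur.
Variables (A : comNzRingType) (P Q : lmodType A).

Definition onto t := exists f : {linear P -> {ffun 'I_t -> Q}},
  forall y, exists x, f x = y.

Lemma onto0 : onto 0.
Proof.
have [|f _] := @mk_linear A P {ffun 'I_0 -> Q} (fun=> 0).
  by move=> a x y; rewrite scaler0 addr0.
by exists f => y; exists 0; apply/ffunP => -[].
Qed.

Lemma onto_le s t : (s <= t)%N -> onto t -> onto s.
Proof.
move=> st [f fS].
have [|h Hh] := @mk_linear A P {ffun 'I_s -> Q}
    (fun x => [ffun i => f x (widen_ord st i)]).
  by move=> a x y; apply/ffunP => i; rewrite !ffunE (linearP f) !ffunE.
exists h => y.
pose z : {ffun 'I_t -> Q} :=
  [ffun i => (if insub (val i) is Some j then y j else 0) : Q].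
have [x Hx] := fS z.
exists x; apply/ffunP => i; rewrite Hh ffunE Hx /z ffunE /=.
by rewrite insubT //= => lt; congr (y _); apply: val_inj.
Qed.

(** [supremum] is a choice with a default, so a least upper bound must be exhibited: +oo if every t
    occurs, and otherwise a maximum, which exists by [onto_le]. *)
Lemma sur_supremum : supremums [set t%:Z%:E | t in onto]%classic (sur P Q).
Proof.
rewrite /sur /supremum; case: eqP => [S0|_].
  have : set0 (0%:Z%:E : \bar int).
    by rewrite -S0; exists 0%N => //; exact: onto0.
  by [].
case: xgetP => [x -> //|H]; exfalso.
pose S := [set t%:Z%:E | t in onto]%classic : set (\bar int).
have Sin n : onto n -> S n%:Z%:E by move=> on; exists n.
have [all|/existsNP[t nt]] := pselect (forall t, onto t).
  apply: (H +oo%E); split=> [x _|[r| |] Hu //]; first exact: leey.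
    have := Hu _ (Sin `|r|.+1 (all _)).
    by rewrite lee_fin => h; exfalso; lia.
  by have := Hu _ (Sin 0%N onto0).
have ex : exists n, `[< onto n >] by exists 0%N; apply/asboolP; exact: onto0.
have bound n : `[< onto n >] -> (n <= t)%N.
  by move=> /asboolP on; rewrite leqNgt; apply/negP => /ltnW /onto_le /(_ on).
have [m /asboolP om mmax] := ex_maxnP ex bound.
apply: (H m%:Z%:E); split=> [_ [n on <-]|u Hu]; last exact: Hu (Sin m om).
by rewrite lee_fin lez_nat; apply: mmax; apply/asboolP.
Qed.

Lemma le_sur t : (t%:Z%:E <= sur P Q)%E <-> onto t.
Proof.
have [ub lb] := sur_supremum; split=> [H|ot]; last by apply: ub; exists t.
apply: contrapT => nt; case: t H nt => [|t] H nt.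
  by apply: nt; exact: onto0.
have : (sur P Q <= t%:Z%:E)%E.
  apply: lb => _ [n on <-]; rewrite lee_fin lez_nat leqNgt; apply/negP => tn.
  exact: nt (onto_le tn on).
by move=> /(le_trans H); rewrite lee_fin lez_nat ltnn.
Qed.

Lemma sur_le t : (forall n, onto n -> (n <= t)%N) -> (sur P Q <= t%:Z%:E)%E.
Proof.
move=> H; have [_ lb] := sur_supremum; apply: lb => _ [n on <-].
by rewrite lee_fin lez_nat; exact: H.
Qed.
End Sur.

(** * Localization *)

Section LocalLemmas.
Variables (R : idomainType) (p : prime_idealr R).

Section One.
Variable M : lmodType R.

Lemma lfrac_lin (a : R) (m n : M) s (sp : s \notin p) (r : local_ring p) :
  val r = tofrac a / tofrac 1 ->
  lfrac (a *: m + n) sp = r *: lfrac m sp + lfrac n sp.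
Proof.
move=> E; rewrite [r *: _](local_scaleE (notin_prime1 p) m sp E).
rewrite [RHS]local_addE.
apply/lfracP; exists 1; first exact: notin_prime1.
by rewrite !scalerDr !scalerA; congr (_ *: _ + _ *: _); ring.
Qed.

Lemma lfracM_den (d : R) (m : M) s (sp : s \notin p) ds (dsp : ds \notin p) :
  ds = d * s -> lfrac (d *: m) dsp = lfrac m sp.
Proof.
move=> E; apply/lfracP; exists 1; first exact: notin_prime1.
by rewrite E !scalerA; congr (_ *: _); ring.
Qed.

Lemma lfrac_surj (x : localization p M) :
  exists m s (sp : s \notin p), x = lfrac m sp.
Proof. by elim/lfracW: x => m s sp; exists m, s, sp. Qed.

Lemma common_den (I : finType) (x : I -> localization p M) :
  exists s (sp : s \notin p) (m : I -> M), forall i, x i = lfrac (m i) sp.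
Proof.
have /choice [m /choice [s Hs]] := fun i => lfrac_surj (x i).
have sp i : s i \notin p by have [? _] := Hs i.
have dp (P : pred I) : \prod_(i | P i) s i \notin p.
  elim/big_ind: _ => //; [exact: notin_prime1|exact: notin_primeM].
exists (\prod_i s i), (dp xpredT).
exists (fun i => (\prod_(j | j != i) s j) *: m i) => i.
have [sip ->] := Hs i; apply/esym/lfracM_den.
by rewrite (bigD1 i) //= mulrC.
Qed.

Lemma local_frac_ex (a s : R) : s \notin p ->
  exists r : local_ring p, val r = tofrac a / tofrac s.
Proof.
move=> sp; have H : tofrac a / tofrac s \in local_pred p.
  by apply/asboolP; exists a, s.
by exists (LocalRing H).
Qed.
End One.

Lemma onto_localization (M N : lmodType R) t : onto M N t ->
  onto (localization p M) (localization p N) t.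
Proof.
move=> [f fS].
pose g (x : localization p M) : {ffun 'I_t -> localization p N} :=
  [ffun i => lfrac (f (pnum (repr x)) i) (frac_denP (repr x))].
have gE m s (sp : s \notin p) i : g (lfrac m sp) i = lfrac (f m i) sp.
  rewrite ffunE; apply/lfracP; have [u up E] := repr_lfrac m sp; exists u => //.
  have := congr1 (fun y => f y i) E; by rewrite !linearZ !ffunE.
have [|G HG] := @mk_linear _ (localization p M)
    {ffun 'I_t -> localization p N} g.
  move=> r x y; apply/ffunP => i.
  have -> : (r *: g x + g y) i = r *: g x i + g y i by rewrite !ffunE.
  elim/lfracW: x => m s sp; elim/lfracW: y => n w wp.
  have rp := local_denP r; have E := local_valE r.
  rewrite [r *: lfrac m sp](local_scaleE rp m sp E) [_ + lfrac n wp]local_addE.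
  rewrite !gE [r *: _](local_scaleE rp _ sp E) [RHS]local_addE.
  by rewrite linearD !linearZ !ffunE /= !scalerA [w * _]mulrC.
exists G => y; have [s [sp [n Hn]]] := common_den y.
have [x Hx] := fS [ffun i => n i].
by exists (lfrac x sp); apply/ffunP => i; rewrite HG gE Hx ffunE.
Qed.

(* A map of localizations lifts to the modules after multiplication by the
   common denominator s of the images of the generators; the factor e kills the
   kernel of N -> N_p. *)
Lemma localization_lift (M N : lmodType R) t (e : R) : fin_gen M ->
  (forall u : R, u \notin p -> exists v, forall x, x \in @Tor_pred _ N ->
     (e * (1 - u * v)) *: x = 0) ->
  onto (localization p M) (localization p N) t ->
  exists H : {linear M -> {ffun 'I_t -> N}},
    (forall x, exists n, H x = e *: n) /\
    forall y, exists u x, u \notin p /\ H x = (e * u) *: y.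
Proof.
move=> [k [g Hg]] eP [f fS].
pose p1 := notin_prime1 p.
have [s [sp [n Hn]]] :=
  common_den (fun z : 'I_k * 'I_t => f (lfrac (g z.1) p1) z.2).
pose lifts x := exists y : {ffun 'I_t -> N},
  forall i, f (lfrac x p1) i = lfrac (y i) sp.
have Q x : lifts x.
  have Qlin a x1 x2 : lifts x1 -> lifts x2 -> lifts (a *: x1 + x2).
    move=> [y1 E1] [y2 E2]; exists (a *: y1 + y2) => i.
    have [r Hr] := local_frac_ex a p1.
    by rewrite !(lfrac_lin _ _ _ Hr) linearP !ffunE (lfrac_lin _ _ _ Hr) E1 E2.
  have [c ->] := Hg x; elim/big_rec: _ => [|j w _ IH].
    exists 0 => i; have -> : lfrac 0 p1 = 0 :> localization p M by [].
    rewrite linear0 !ffunE; apply/lfracP; exists 1; first exact: p1.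
    by rewrite !scaler0.
  by apply: Qlin => //; exists [ffun i => n (j, i)] => i; rewrite ffunE -Hn.
have /choice [nu Hnu] := Q.
(* The coordinates of y1 - y2 are killed by u s outside p, so they are torsion; there e acts as e u
   s v, that is, as zero. Hence e y depends only on the fractions y / s, and x |-> e nu(x) is linear
   although nu is merely chosen. *)
have uniq_e (y1 y2 : {ffun 'I_t -> N}) :
    (forall i, lfrac (y1 i) sp = lfrac (y2 i) sp) ->
    e *: y1 = e *: y2.
  move=> E; apply/ffunP => i; rewrite !ffunE; apply/eqP.
  rewrite -subr_eq0 -scalerBr.
  have /lfracP[u up /eqP] := E i; rewrite -subr_eq0 -scalerBr => /eqP us.
  have usp := notin_primeM up sp.
  have [v Hv] := eP _ usp.
  have us0 : u * s != 0 by rewrite -tofrac_eq0; apply: tofrac_notin usp.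
  have := Hv (y1 i - y2 i); rewrite mulrBr mulr1 scalerBl.
  have -> : e * (u * s * v) = (e * v) * (u * s) by ring.
  rewrite -scalerA us scaler0 subr0 => -> //.
  by apply/asboolP; exists (u * s).
have [|H HH] := @mk_linear R M {ffun 'I_t -> N} (fun x => e *: nu x).
  move=> a x y.
  have -> : a *: (e *: nu x) + e *: nu y = e *: (a *: nu x + nu y).
    by rewrite scalerDr !scalerA mulrC.
  apply: uniq_e => i; rewrite -Hnu; have [r Hr] := local_frac_ex a p1.
  by rewrite !(lfrac_lin _ _ _ Hr) linearP !ffunE (lfrac_lin _ _ _ Hr) !Hnu.
exists H; split=> [x|y]; first by exists (nu x); rewrite HH.
have [z Hz] := fS [ffun i => lfrac (y i) p1].
have [x [w [wp zE]]] := lfrac_surj z.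
(* The factor s comes from the denominator in [nu], and w is the denominator of a preimage x / w of
   y. *)
exists (s * w), x; split; first exact: notin_primeM.
rewrite HH -scalerA; apply: uniq_e => i; rewrite -Hnu !ffunE.
have [r Hr] := local_frac_ex w p1.
have E : lfrac x p1 = r *: z.
  rewrite zE [RHS](local_scaleE p1 x wp Hr); apply/esym/lfracM_den.
  by rewrite mulrC.
rewrite E linearZ ffunE Hz ffunE [LHS](local_scaleE p1 _ p1 Hr).
apply/lfracP; exists 1; first exact: p1.
by rewrite !scalerA; congr (_ *: _); ring.
Qed.

End LocalLemmas.

(** * Comparison of torsion-free modules and of kernels at a prime *)

Section LocalIso.
Variable R : idomainType.
Hypothesis hR : dedekind R.
Variable p : prime_idealr R.
Implicit Types M N P F : lmodType R.
Implicit Types I J : submodClosed R^o.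

Lemma prime_ideal : ideal (fun x => x \in p).
Proof. by split=> [|a x y xp yp]; rewrite ?idealr0 // rpredD ?idealMr. Qed.

(** The functionals h and k have values h x and k y outside p, so x and y generate I and J locally.
    The map w |-> h(w) y sends k(z) x to h(x) k(y) z, by [hom_comm]. *)
Lemma ideal_local_onto I J : nonzero I -> nonzero J ->
  exists f : {linear submod I -> submod J},
    forall z, exists (u : R) w, u \notin p /\ f w = u *: z.
Proof.
move=> I0 J0.
have p1 : ~ (1 \in p) by apply/negP; exact: notin_prime1.
have [h [x /negP hx]] := ideal_hom_notin hR I0 prime_ideal p1.
have [k [y /negP ky]] := ideal_hom_notin hR J0 prime_ideal p1.
have [|f Hf] := @mk_linear R (submod I) (submod J) (fun w => (h w : R) *: y).
  by move=> a u v; rewrite (linearP h) regZ scalerDl scalerA.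
exists f => z; exists ((h x : R) * (k y : R)), ((k z : R) *: x); split.
  exact: notin_primeM.
rewrite Hf linearZ /= regZ; apply: val_inj => /=; rewrite !regZ.
by rewrite mulrAC [_ * h x]mulrC -mulrA hom_comm mulrA.
Qed.

Lemma tfree_local_onto P Q n : fin_gen P -> tfree P -> has_rank P n ->
  fin_gen Q -> tfree Q -> has_rank Q n ->
  exists f : {linear P -> Q},
    forall z, exists (u : R) w, u \notin p /\ f w = u *: z.
Proof.
move=> Pf Pt Pn Qf Qt Qn; case: n Pn Qn => [|n] Pn Qn.
  have [|f Hf] := @mk_linear R P Q (fun=> 0).
    by move=> a x y; rewrite scaler0 addr0.
  exists f => z; exists 1, 0; rewrite (rank0_eq0 Qt Qn z) Hf scaler0.
  by split=> //; exact: notin_prime1.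
have [I [I0 PI]] := structure hR Pf Pt Pn.
have [J [J0 QJ]] := structure hR Qf Qt Qn.
have [h Hh] := ideal_local_onto I0 J0.
have [f [f' [fK f'K]]] := iso_lin PI; have [g [g' [gK g'K]]] := iso_lin QJ.
have [|k Hk] := @mk_linear R P Q (fun x => g' ((f x).1, h (f x).2)).
  move=> a x y; rewrite -(linearP g') (linearP f); congr (g' (_, _)).
  exact: (linearP h).
exists k => z; have [u [w [up E]]] := Hh (g z).2.
exists u, (f' (u *: (g z).1, w)); split=> //; rewrite Hk f'K /= E.
by rewrite -[(_, _)]/(u *: g z) linearZ /= gK.
Qed.

Lemma modTor_section M : fin_gen M -> exists (q : {linear M -> modTor M})
    (s : {linear modTor M -> M}),
  [/\ forall y, exists x, q x = y,
      forall x, q x = 0 <-> x \in @Tor_pred _ M & cancel s q].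
Proof.
move=> Mf; have [q [qS qE]] := modTor_pi M.
have [r [rT rE]] := retract_Tor hR Mf.
have [|h Hh] := @mk_linear R M M (fun x => x - r x).
  by move=> a x y; rewrite (linearP r) scalerBr opprD addrACA.
have [|s Hs] := lin_factor (g := h) qS.
  by move=> x /qE xT; rewrite Hh rE // subrr.
exists q, s; split=> // y; have [x <-] := qS y.
by rewrite Hs Hh linearB (iffRL (qE _) (rT x)) subr0.
Qed.

(* Kernels of the same rank agree locally at p: both are Tor M plus a
   torsion-free module of that rank. *)
Lemma ker_local_onto M F (g g' : {linear M -> F}) n : fin_gen M -> fin_gen F ->
  tfree F -> has_rank (submod (kerp g)) n -> has_rank (submod (kerp g')) n ->
  exists f : {linear M -> M}, (forall x, g x = 0 -> g' (f x) = 0) /\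
    forall x, g' x = 0 ->
      exists (u : R) y, [/\ u \notin p, g y = 0 & f y = u *: x].
Proof.
move=> Mf Ff Ft gn g'n.
have [r [rT rE]] := retract_Tor hR Mf.
have torF (h : {linear M -> F}) x : x \in @Tor_pred _ M -> h x = 0.
  by move=> /asboolP[a a0 E]; apply: (Ft a) => //; rewrite -linearZ E linear0.
pose L := submod (kerp g); pose L' := submod (kerp g').
have Lf : fin_gen L by exact: fin_gen_ker.
have L'f : fin_gen L' by exact: fin_gen_ker.
have [q [s [qS qE _]]] := modTor_section Lf.
have [q' [s' [q'S q'E s'K]]] := modTor_section L'f.
have [||||||h Hh] := @tfree_local_onto (modTor L) (modTor L') n.
- exact: fin_gen_surj Lf.
- exact: tfree_modTor.
- exact: has_rank_modTor.
- exact: fin_gen_surj L'f.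
- exact: tfree_modTor.
- exact: has_rank_modTor.
have [k [k0 kE]] := retract_ker hR g Ff Ft.
have kg x : k x \in kerp g by apply/eqP.
(* On the kernel of g, f keeps the torsion part given by r and applies h to the torsion-free
   quotient; the retraction k extends it to M. *)
have [|f Hf] := @mk_linear R M M
    (fun x => r (k x) + val (s' (h (q (Submod (kg x)))))).
  move=> a x y.
  have -> : Submod (kg (a *: x + y)) = a *: Submod (kg x) + Submod (kg y).
    by apply: val_inj; rewrite /= (linearP k).
  rewrite (linearP k) (linearP r) (linearP q) (linearP h) (linearP s').
  by rewrite scalerDr addrACA.
have valT (S : submodClosed M) (z : submod S) : z \in @Tor_pred _ (submod S) ->
    val z \in @Tor_pred _ M.
  move=> /asboolP[a a0 E]; apply/asboolP; exists a => //.
  exact: (congr1 (@submod_val _ _ _) E).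
exists f; split=> [x _|x gx].
  rewrite Hf linearD torF // add0r; apply/eqP; exact: (valP (s' _)).
pose x1 : L' := Submod (introT eqP gx : x \in kerp g').
have [u [w [up hw]]] := Hh (q' x1); have [l0 ql0] := qS w.
pose z : L' := u *: x1 - s' (h w).
have zT : z \in @Tor_pred _ L'.
  by apply/q'E; rewrite linearB s'K hw linearZ subrr.
(* Replace the torsion part of the lift l0 by the error z. Then f y = z + s'(h w) = u x. *)
pose y := val l0 - r (val l0) + val z.
have gy : g y = 0.
  rewrite /y linearD linearB (torF g (r _)) // (torF g (val z));
    last exact: valT.
  rewrite subr0 addr0.
  by apply/eqP; exact: (valP l0).
exists u, y; split=> //.
have ky : k y = y by exact: kE.
have ry : r y = val z.
  by rewrite /y linearD linearB (rE (r _)) // subrr add0r rE //; exact: valT.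
have qy : q (Submod (kg y)) = q l0.
  apply/eqP; rewrite -subr_eq0 -linearB; apply/eqP/qE.
  have : - r (val l0) + val z \in @Tor_pred _ M.
    by apply: rpredD; [rewrite rpredN; exact: rT|exact: valT].
  move=> /asboolP[a a0 E]; apply/asboolP; exists a => //; apply: val_inj => /=.
  by rewrite ky /y -[_ - _ + _]addrA addrAC subrr add0r.
by rewrite Hf qy ky ry ql0 /z /= subrK.
Qed.
End LocalIso.

(** * Gluing local surjections *)

Section Main.
Variable R : idomainType.
Hypothesis hR : dedekind R.
Implicit Types M N F : lmodType R.

Definition torsion_ann N (a : R) :=
  forall x : N, x \in @Tor_pred _ N -> a *: x = 0.

Lemma torsion_ann_ideal N : ideal (torsion_ann N).
Proof.
split=> [x _|a b c Hb Hc x xT]; first by rewrite scale0r.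
by rewrite scalerDl -scalerA Hb // Hc // scaler0 addr0.
Qed.

(** The torsion submodule is the image of the retraction r, so it is generated by the r(g_j);
    multiply annihilators of these. *)
Lemma torsion_ann_nonzero N : fin_gen N -> exists2 a, torsion_ann N a & a != 0.
Proof.
move=> Nf; have [r [rT rE]] := retract_Tor hR Nf; have [k [g Hg]] := Nf.
have /choice [a Ha] : forall j, exists a, a != 0 /\ a *: r (g j) = 0.
  by move=> j; have /asboolP[a a0 E] := rT (g j); exists a.
exists (\prod_j a j); last by apply/prodf_neq0 => j _; have [] := Ha j.
move=> x /rE <-; have [c ->] := Hg x.
rewrite lin_comb scaler_sumr big1 // => j _.
rewrite (bigD1 j) //= scalerA -mulrA mulrC -scalerA.
by rewrite (Ha j).2 scaler0.
Qed.

(* Kill the generators of m one at a time, using that m is nilpotent on e x. *)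
Lemma loc_at_Ass N m e : loc_at (torsion_ann N) m e ->
  exists x : N, forall a, m a <-> a *: x = 0.
Proof.
move=> em; have Ji := torsion_ann_ideal N; have mi := loc_at_ideal Ji em.
have [nJe mU mE] := em.
have [x0 [x0T ex0]] : exists x0 : N, x0 \in @Tor_pred _ N /\ e *: x0 != 0.
  apply: contrapT => H; apply: nJe => x xT; apply: contrapT => /eqP ex.
  by apply: H; exists x.
have [n [a [am ma]]] := ideal_gen hR mi.
have [r [er ar]] : exists r, (e * r) *: x0 != 0 /\
    forall i, (a i * (e * r)) *: x0 = 0.
  suff /(_ n)[r [er ar]] : forall k, exists r, (e * r) *: x0 != 0 /\
      forall i : 'I_n, (i < k)%N -> (a i * (e * r)) *: x0 = 0.
    by exists r; split=> // i; exact: ar.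
  elim=> [|k [r [er ar]]]; first by exists 1; rewrite mulr1.
  have [kn|nk] := ltnP k n; last first.
    by exists r; split=> // i _; apply: ar; exact: leq_trans (ltn_ord i) nk.
  pose ak := a (Ordinal kn).
  have ex : exists l, (e * r * ak ^+ l) *: x0 == 0.
    have [l Hl] := (mE ak).1 (am _); exists l.
    by rewrite mulrAC mulrC -scalerA Hl // scaler0.
  (* Multiply by the last power of [ak] that does not kill the element; the minimal exponent is
     positive because e r x0 is nonzero. *)
  case: (ex_minnP ex) => -[|l] /eqP l0 lmin.
    by move: er; rewrite -[e * r]mulr1 -(expr0 ak) l0 eqxx.
  exists (r * ak ^+ l); rewrite mulrA; split.
    by apply/negP => /lmin; rewrite ltnn.
  move=> i; rewrite ltnS leq_eqVlt => /orP[/eqP ik|ik]; last first.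
    by rewrite mulrA mulrC -scalerA ar // scaler0.
  have -> : i = Ordinal kn by apply: val_inj.
  by rewrite -[RHS]l0 -/ak exprSr; congr (_ *: _); ring.
exists ((e * r) *: x0) => b; split=> [/ma[c ->]|bx].
  rewrite scaler_suml big1 // => i _.
  by rewrite scalerA -mulrA -scalerA ar scaler0.
(* An element b outside m has an inverse v modulo J : e, so it cannot kill the nonzero element e r
   x0. *)
apply: contrapT => /mU[v Hv].
have := Hv x0 x0T => /(congr1 (fun y => r *: y)); rewrite scaler0 scalerA.
have -> : r * (e * (1 - b * v)) = e * r - v * (b * (e * r)) by ring.
rewrite scalerBl -[(v * _) *: _]scalerA -[(b * _) *: _]scalerA bx scaler0 subr0.
by move/eqP; rewrite (negPf er).
Qed.

(** Torsion cokernels are allowed because a map lifted from a localization reaches only nonzero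
    multiples of each element. *)
Lemma rank_ker M F (g : {linear M -> F}) q :
  fin_gen M -> fin_gen F -> tfree F ->
  has_rank F q -> (forall y, exists a x, a != 0 /\ a *: y = g x) ->
  exists n, has_rank (submod (kerp g)) n /\ rank M = (n + q)%N.
Proof.
move=> Mf Ff Ft Fq gS.
have [n Kn] := fin_gen_rank (fin_gen_ker hR g Mf Ff Ft).
have [i Hi] := submod_val_lin (kerp g).
exists n; split=> //; apply: rankE; apply: (has_rankD (i := i) (g := g)) => //.
- by move=> y; rewrite Hi => y0; have -> : y = 0; [exact: val_inj|exact: rpred0].
- by move=> y; rewrite Hi; apply/eqP; exact: (valP y).
move=> x /eqP gx; exists 1, (Submod (gx : x \in kerp g)).
by rewrite oner_neq0 scale1r Hi.
Qed.

Section Target.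
Variables (N : lmodType R) (t : nat).
Hypothesis Nf : fin_gen N.

Lemma fin_gen_target : fin_gen {ffun 'I_t -> modTor N}.
Proof.
by have [q [qS _]] := modTor_pi N; apply: fin_gen_ffun; exact: fin_gen_surj Nf.
Qed.

Lemma tfree_target : tfree {ffun 'I_t -> modTor N}.
Proof. by apply: tfree_ffun; exact: tfree_modTor. Qed.

Lemma has_rank_target : has_rank {ffun 'I_t -> modTor N} (t * rank N).
Proof. by apply: has_rank_ffun; apply: has_rank_modTor; exact: rankP. Qed.
End Target.

(* At e local with prime p, a surjection of localizations lifts to H : M -> N^t;
   where H is torsion it covers e Tor(N)^t, and ker g maps there locally onto. *)
Lemma ker_onto_torsion M N t (g : {linear M -> {ffun 'I_t -> modTor N}}) n :
  fin_gen M -> fin_gen N -> has_rank (submod (kerp g)) n ->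
  rank M = (n + t * rank N)%N ->
  (forall p : prime_idealr R, Ass N p -> ~ (p =i pred1 0) ->
     onto (localization p M) (localization p N) t) ->
  exists f : {linear M -> {ffun 'I_t -> N}}, forall y : {ffun 'I_t -> N},
    (forall i, y i \in @Tor_pred _ N) -> exists x, g x = 0 /\ f x = y.
Proof.
move=> Mf Nf Kn Mn loc.
have Ji := torsion_ann_ideal N.
pose T (y : {ffun 'I_t -> N}) := forall i, y i \in @Tor_pred _ N.
have annT a y : torsion_ann N a -> T y -> a *: y = 0.
  by move=> Ja yT; apply/ffunP => i; rewrite !ffunE Ja.
(* The first clause, that f maps ker g into e Tor(N)^t, serves the gluing: it makes the cross terms
   vanish. *)
pose P (e : R) := exists f : {linear M -> {ffun 'I_t -> N}},
  (forall x, g x = 0 -> exists y, T y /\ f x = e *: y) /\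
  (forall y, T y -> exists x, g x = 0 /\ f x = e *: y).
suff [f [_ fS]] : P 1.
  by exists f => y /fS; rewrite scale1r.
apply: (ded_ind hR Ji (torsion_ann_nonzero Nf)) => [e Je|m e em|b c e bc Jebc].
- have [|f Hf] := @mk_linear R M {ffun 'I_t -> N} (fun=> 0).
    by move=> a x y; rewrite scaler0 addr0.
  exists f; split=> [x _|y yT].
    exists 0; split; first by move=> i; rewrite ffunE; exact: rpred0.
    by rewrite Hf scaler0.
  by exists 0; rewrite !linear0 annT.
- have [nJe mU _] := em.
  have [p [pE pn0]] := loc_at_prime Ji em (torsion_ann_nonzero Nf).
  have pA : Ass N p.
    have [x xE] := loc_at_Ass em; exists x => a.
    by apply/idP/eqP => [/pE/xE //|/xE/pE].
  have [|H [HE HS]] := localization_lift (e := e) Mf _ (loc p pA pn0).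
    by move=> u /negP up; have [|v Hv] := mU u; [move/pE|exists v].
  have [q [qS qE]] := modTor_pi N.
  have [qt qtE] := lin_ffun t q.
  have [g' Hg'] := lin_comp qt H.
  have Ff := fin_gen_target t Nf; have Ft := @tfree_target N t.
  have Fr := has_rank_target t Nf.
  have e0 : e != 0 by apply/eqP => e0; apply: nJe => x _; rewrite e0 scale0r.
  have [y|n' [Kn' Mn']] := rank_ker (g := g') Mf Ff Ft Fr.
    have [z Hz] : exists z : {ffun 'I_t -> N}, qt z = y.
      have /choice [s Hs] := qS; exists [ffun i => s (y i)].
      by rewrite qtE; apply/ffunP => i; rewrite !ffunE.
    have [u [x [up Hx]]] := HS z; exists (e * u), x.
    split; last by rewrite Hg' Hx linearZ Hz.
    by rewrite mulf_neq0 //; apply: contraNneq up => ->; exact: idealr0.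
  (* Both kernels have rank [rank M - t * rank N]: for g by hypothesis, for g' because its cokernel
     is torsion. *)
  have nn : n' = n by apply/eqP; rewrite -(eqn_add2r (t * rank N)) -Mn -Mn'.
  rewrite nn in Kn'.
  have [h [h0 hS]] := ker_local_onto hR p Mf Ff Ft Kn Kn'.
  have [f Hf] := lin_comp H h; exists f; split=> [x gx|y yT].
    have [y Hy] := HE (h x); exists y; rewrite Hf; split=> // i.
    have := h0 _ gx; rewrite Hg' Hy qtE => /ffunP/(_ i); rewrite !ffunE.
    by rewrite linearZ => E; apply/qE; apply: (tfree_modTor e0 E).
  have [u [x [up Hx]]] := HS y.
  have [|w [l [wp gl hl]]] := hS x.
    rewrite Hg' Hx linearZ qtE; apply/ffunP => i; rewrite !ffunE.
    by rewrite (iffRL (qE _) (yT i)) scaler0.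
  have uwp : ~ m (u * w).
    by move/pE; apply/negP; exact: notin_primeM.
  have [v Hv] := mU _ uwp.
  exists (v *: l); split; first by rewrite linearZ /= gl scaler0.
  rewrite Hf !linearZ /= hl linearZ /= Hx !scalerA.
  (* f l = w (e u) y, and v inverts u w modulo J : e; the remainder e (1 - u w v) lies in J and
     kills y. *)
  have -> : e = v * (w * (e * u)) + e * (1 - u * w * v) by ring.
  rewrite [in RHS]scalerDl (annT (e * _)) // addr0.
  congr (_ *: _); ring.
move=> [f [f1 f2]] [h [h1 h2]].
have [|k Hk] := @mk_linear R M {ffun 'I_t -> N} (fun x => f x + h x).
  by move=> a x y; rewrite (linearP f) (linearP h) scalerDr addrACA.
have TD a x y : T x -> T y -> T (a *: x + y).
  by move=> xT yT i; rewrite !ffunE; apply: rpredD; [apply: rpredZ|].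
exists k; split=> [x gx|y yT].
  have [y [yT fy]] := f1 x gx; have [z [zT hz]] := h1 x gx.
  exists (b *: y + (c *: z + 0)); split.
    by do 2?apply: (TD) => //; move=> i; rewrite ffunE rpred0.
  by rewrite Hk fy hz addr0 scalerDr !scalerA.
have [x [gx fx]] := f2 y yT; have [x' [gx' hx']] := h2 y yT.
have [z [zT fz]] := f1 x' gx'; have [z' [z'T hz']] := h1 x gx.
(* The cross terms c f(x') and b h(x) are e b c times torsion, hence zero; what remains is (e b^2 +
   e c^2) y, equal to e y since 1 = (b + c)^2 and 2 e b c lies in J. *)
exists (b *: x + c *: x'); split.
  by rewrite linearD !linearZ /= gx gx' !scaler0 addr0.
rewrite Hk !linearD !linearZ /= fx hx' fz hz' !scalerA.
have -> : c * (e * b) = e * b * c by ring.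
have -> : b * (e * c) = e * b * c by ring.
rewrite !(annT (e * b * c)) // addr0 add0r -scalerDl.
have E : e = b * (e * b) + c * (e * c) + 2%:R * (e * b * c).
  have -> : c = 1 - b by rewrite -bc addrAC subrr add0r.
  ring.
rewrite [e in RHS]E [RHS]scalerDl -[(2%:R * _) *: _]scalerA.
rewrite (annT (e * b * c)) //.
by rewrite scaler0 addr0.
Qed.

Lemma proj_onto M t : fin_gen M -> exists (q : {linear M -> modTor M})
    (s : {linear modTor M -> M})
    (qt : {linear {ffun 'I_t -> M} -> {ffun 'I_t -> modTor M}})
    (st : {linear {ffun 'I_t -> modTor M} -> {ffun 'I_t -> M}}),
  [/\ forall y, exists x, q x = y, forall x, q x = 0 <-> x \in @Tor_pred _ M,
    forall x, qt x = 0 <-> forall i, x i \in @Tor_pred _ M & cancel st qt].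
Proof.
move=> Mf; have [q [s [qS qE sK]]] := modTor_section hR Mf.
have [qt Hqt] := lin_ffun t q; have [st Hst] := lin_ffun t s.
exists q, s, qt, st; split=> // [x|y]; last first.
  by rewrite Hqt Hst; apply/ffunP => i; rewrite !ffunE sK.
rewrite Hqt; split=> [/ffunP E i|xT].
  by apply/qE; have := E i; rewrite !ffunE.
by apply/ffunP => i; rewrite !ffunE; apply/qE.
Qed.

(** The retraction k splits M into ker g and a complement, and st splits N^t into Tor(N)^t and F; h
    is f on the first part and g on the second. *)
Lemma onto_of_target M N t (g : {linear M -> {ffun 'I_t -> modTor N}}) :
  fin_gen M -> fin_gen N -> (forall y, exists x, g x = y) ->
  (forall p : prime_idealr R, Ass N p -> ~ (p =i pred1 0) ->
     onto (localization p M) (localization p N) t) ->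
  onto M N t.
Proof.
move=> Mf Nf gS loc.
have Ff := fin_gen_target t Nf; have Ft := @tfree_target N t.
have [y|n [Kn Mn]] := rank_ker (g := g) Mf Ff Ft (has_rank_target t Nf).
  by have [x <-] := gS y; exists 1, x; rewrite oner_neq0 scale1r.
have [f fS] := ker_onto_torsion Mf Nf Kn Mn loc.
have [k [k0 kE]] := retract_ker hR g Ff Ft.
have [q [s [qt [st [qS qE qtE stK]]]]] := proj_onto t Nf.
have [|h Hh] := @mk_linear R M {ffun 'I_t -> N} (fun x => f (k x) + st (g x)).
  move=> a x y; rewrite (linearP k) (linearP f) (linearP g) (linearP st).
  by rewrite scalerDr addrACA.
exists h => y; have [x gx] := gS (qt y).
have [|z [gz fz]] := fS (y - st (qt y)).
  by apply/qtE; rewrite linearB stK subrr.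
exists (x - k x + z).
have kx : k (x - k x + z) = z.
  by rewrite linearD linearB (kE (k x)) // subrr add0r kE.
have gxz : g (x - k x + z) = qt y by rewrite linearD linearB k0 gz subr0 addr0.
by rewrite Hh kx fz gxz subrK.
Qed.

(** * Conditions on ranks and Steinitz classes *)

Lemma modTor_iso_target M N t : fin_gen M -> fin_gen N -> (0 < t)%N ->
  (0 < rank N)%N -> rank M = (t * rank N)%N ->
  steinitz M = (steinitz N ^+ t)%g <->
  iso_mod (modTor M) {ffun 'I_t -> modTor N}.
Proof.
case: t => // t Mf Nf _; case Ns: (rank N) => [//|s] _ Mr.
have [J [J0 [-> NJ]]] := steinitzP hR Nf Ns.
have [|I [I0 [-> MI]]] := @steinitzP R hR M (t.+1 * s.+1).-1 Mf.
  by rewrite Mr mulSn.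
have [L [L0 [<- FL]]] := steinitz_pow hR J0 t NJ.
split=> [/Pic_class_iso IL|MF].
  apply: iso_trans MI _; apply: iso_trans (iso_sym FL).
  by apply: iso_prod; first exact: iso_refl.
apply/Pic_class_eq; apply: (steinitz_unique I0 L0).
exact: iso_trans (iso_sym MI) (iso_trans MF FL).
Qed.

Lemma modTor_onto_target M N t : fin_gen M -> fin_gen N ->
  (exists f : {linear modTor M -> {ffun 'I_t -> modTor N}},
     forall y, exists x, f x = y) ->
  exists g : {linear M -> {ffun 'I_t -> modTor N}}, forall y, exists x, g x = y.
Proof.
move=> Mf Nf [f fS]; have [q [qS _]] := modTor_pi M.
have [g Hg] := lin_comp f q.
exists g => y; have [z <-] := fS y; have [x <-] := qS z.
by exists x; rewrite Hg.
Qed.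

(** The surjection f is returned along with g so that [onto_Tor] can recognize ker g as the preimage
    of the torsion of N^t. *)
Lemma onto_rank M N t : fin_gen M -> fin_gen N -> onto M N t ->
  exists n (g : {linear M -> {ffun 'I_t -> modTor N}}),
  [/\ rank M = (n + t * rank N)%N, has_rank (submod (kerp g)) n,
    forall y, exists x, g x = y &
    exists2 f : {linear M -> {ffun 'I_t -> N}}, (forall y, exists x, f x = y) &
      forall x, g x = 0 <-> forall i, f x i \in @Tor_pred _ N].
Proof.
move=> Mf Nf [f fS].
have [q [s [qt [st [qS qE qtE stK]]]]] := proj_onto t Nf.
have [g Hg] := lin_comp qt f.
have gS y : exists x, g x = y.
  by have [x Hx] := fS (st y); exists x; rewrite Hg Hx stK.
have [y|n [Kn Mn]] := rank_ker (g := g) Mf (fin_gen_target t Nf)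
   (@tfree_target N t) (has_rank_target t Nf).
  by have [x <-] := gS y; exists 1, x; rewrite oner_neq0 scale1r.
by exists n, g; split=> //; exists f => // x; rewrite Hg.
Qed.

Lemma ker_rank0 M F (g : {linear M -> F}) x : has_rank (submod (kerp g)) 0 ->
  g x = 0 -> x \in @Tor_pred _ M.
Proof.
move=> [b [_ bs]] /eqP gx; have [a [c [a0]]] := bs (Submod (gx : x \in kerp g)).
rewrite big_ord0 => /(congr1 (@submod_val _ _ _)) E; apply/asboolP.
by exists a.
Qed.

Lemma onto_rank_cond M N t :
  fin_gen M -> fin_gen N -> (0 < t)%N -> onto M N t ->
  [\/ rank N = 0%N, (1 + t * rank N <= rank M)%N |
    [/\ rank M = (t * rank N)%N, (t <= t * rank N)%N &
        steinitz M = (steinitz N ^+ t)%g]].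
Proof.
move=> Mf Nf t0 /(onto_rank Mf Nf) [n [g [Mn Kn gS [f fS gE]]]].
case: (posnP (rank N)) => [|N0]; first by constructor 1.
case: n Mn Kn => [|n] Mn Kn; last by constructor 2; rewrite Mn leq_add2r.
constructor 3; rewrite Mn; split=> //; first by rewrite leq_pmulr.
apply/(modTor_iso_target Mf Nf t0 N0 Mn).
have [q [qS qE]] := modTor_pi M.
have [|h Hh] := lin_factor (g := g) qS.
  move=> x /qE/asboolP[a a0 E]; apply: (@tfree_target N t a) => //.
  by rewrite -linearZ E linear0.
apply: (@mk_iso _ _ _ h) => [a x y|y|z]; first by rewrite linearP.
  have [x <-] := qS y; rewrite Hh => gx; apply/qE; exact: ker_rank0 Kn gx.
by have [x <-] := gS z; exists (q x).
Qed.

Lemma onto_Tor M N t : fin_gen M -> fin_gen N -> rank M = (t * rank N)%N ->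
  onto M N t -> onto (Tor M) (Tor N) t.
Proof.
move=> Mf Nf Mr /(onto_rank Mf Nf) [n [g [Mn Kn gS [f fS gE]]]].
have n0 : n = 0%N.
  by move/eqP: Mn; rewrite Mr -{1}[(t * _)%N]add0n eqn_add2r => /eqP.
rewrite n0 in Kn.
have fT (x : Tor M) i : f (val x) i \in @Tor_pred _ N.
  have /asboolP[a a0 E] := valP x; apply/asboolP; exists a => //.
  by have := congr1 (fun z => f z i) E; rewrite linearZ linear0 !ffunE.
have [|h Hh] := @mk_linear R (Tor M) {ffun 'I_t -> Tor N}
    (fun x => [ffun i => Submod (fT x i) : Tor N]).
  move=> a x y; apply/ffunP => i; rewrite !ffunE; apply: val_inj.
  by rewrite /= linearP !ffunE.
exists h => y; have [x fx] := fS [ffun i => val (y i)].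
have xT : x \in @Tor_pred _ M.
  by apply: ker_rank0 Kn _; apply/gE => i; rewrite fx ffunE; exact: valP.
exists (Submod xT); apply/ffunP => i; rewrite Hh ffunE; apply: val_inj.
by rewrite /= fx ffunE.
Qed.

Lemma onto_of_rank_cond M N t : fin_gen M -> fin_gen N -> (0 < t)%N ->
  (forall p : prime_idealr R, Ass N p -> ~ (p =i pred1 0) ->
     onto (localization p M) (localization p N) t) ->
  [\/ rank N = 0%N, (1 + t * rank N <= rank M)%N |
    [/\ rank M = (t * rank N)%N, (t <= t * rank N)%N &
        steinitz M = (steinitz N ^+ t)%g]] -> onto M N t.
Proof.
move=> Mf Nf t0 loc H.
suff [g gS] : exists g : {linear M -> {ffun 'I_t -> modTor N}},
    forall y, exists x, g x = y by exact: onto_of_target gS loc.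
have Ff := fin_gen_target t Nf; have Ft := @tfree_target N t.
have Fr := has_rank_target t Nf.
have [q [qS qE]] := modTor_pi M.
case: H => [N0|lt|[Mr]].
- have [|g Hg] := @mk_linear R M {ffun 'I_t -> modTor N} (fun=> 0).
    by move=> a x y; rewrite scaler0 addr0.
  rewrite N0 muln0 in Fr.
  by exists g => y; exists 0; rewrite linear0 (rank0_eq0 Ft Fr y).
- apply: (modTor_onto_target Mf Nf).
  apply: (surj_rank_lt hR _ _ (has_rank_modTor (rankP Mf)) Ff Ft Fr lt).
    exact: fin_gen_surj Mf.
  exact: tfree_modTor.
(* As t > 0, the inequality [t <= t * rank N] says that [rank N] is positive. *)
rewrite -{1}[t]muln1 leq_pmul2l // => N0 /(modTor_iso_target Mf Nf t0 N0 Mr).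
move=> /iso_lin [f [f' [_ f'K]]]; apply: (modTor_onto_target Mf Nf).
by exists f => y; exists (f' y).
Qed.

End Main.

Theorem proposition7p3 (R : idomainType) (M N : lmodType R) (t : nat)
    (hR : dedekind R) (hM : fin_gen M) (hN : fin_gen N) (ht : (0 < t)%N) :
  let cond3 :=
    [/\ rank M = (t * rank N)%N, (t <= t * rank N)%N &
        steinitz M = (steinitz N ^+ t)%g] in
  ((t%:Z%:E <= sur M N)%E <->
    (forall m : prime_idealr R, Ass N m -> ~ (m =i pred1 0) ->
      (t%:Z%:E <= sur (localization m M) (localization m N))%E) /\
    [\/ rank N = 0%N, (1 + t * rank N <= rank M)%N | cond3])
  /\ ((t%:Z%:E <= sur M N)%E -> cond3 ->
        (t%:Z%:E <= sur (Tor M) (Tor N))%E /\ sur M N = t%:Z%:E).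
Proof.
move=> cond3; split; first split.
- move=> /le_sur MN; split; last exact: onto_rank_cond.
  by move=> m _ _; apply/le_sur; exact: onto_localization.
- move=> [loc H]; apply/le_sur; apply: onto_of_rank_cond => // m mA m0.
  by apply/le_sur; exact: loc.
move=> tMN [Mr tr _]; have MN := (le_sur M N t).1 tMN.
split; first by apply/le_sur; exact: onto_Tor.
(* A surjection onto N^n forces n rank N <= rank M = t rank N, and rank N is positive. *)
apply/eqP; rewrite eq_le tMN andbT; apply: sur_le => n /(onto_rank hR hM hN).
have N0 : (0 < rank N)%N by rewrite -(leq_pmul2l ht) muln1.
move=> [k [_ [Mk _ _ _]]].
by rewrite -(leq_pmul2r N0) -Mr Mk leq_addl.
Qed.
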